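(* Any language $L$ that is linear-space reducible to $L_{KG}$ is verified by a 2ADfA with bounded error $\epsilon$, moreover, the protocol achieves perfect completeness.
   Context: The Knapsack-game language is $L_{KG}=\{ S\, \forall(a_1,b_1)\, \exists(e_1,f_1)\, \cdots \, \forall(a_n,b_n)\, \exists(e_n,f_n) \}$, where $S$ and each $a_i,b_i,e_i,f_i$ are natural numbers given in binary, and for every $x\in \prod_{i=1}^{n}\{a_i,b_i\}$ there exists $y\in \prod_{i=1}^{n}\{e_i,f_i\}$ with $S=\sum_{i=1}^{n}(x_i+y_i)$. An affine state of an $m$-state affine register is a vector $v\in\mathbb{R}^m$ whose entries sum to $1$; affine operators are real matrices whose columns each sum to $1$; weighting observes basis state $e_j$ with probability $|v_j|/\|v\|_1$. A 2ADfA is a two-way deterministic finite automaton on the read-only input $¢ w\$$ (left end-marker ¢, right end-marker \$) equipped with finitely many affine registers (with rational transition matrices), each updated by an affine operator or weighted at each step, with the deterministic state and head move then depending on state, symbol and weighting outcomes; it halts upon entering an accepting or rejecting state. The 2ADfA is the verifier in an Arthur–Merlin proof system (public coins: deterministic states, head moves and weighting outcomes are revealed to the all-powerful prover). Verification with error $\epsilon<1/2$ (rational): some prover makes every $w\in L$ accepted with probability at least $1-\epsilon$, and for every $w\notin L$ and every prover, $w$ is rejected with probability at least $1-\epsilon$. Perfect completeness means every $w\in L$ is accepted with probability $1$. *)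

(* Defs.v *)
(* All probabilities are rational (rational matrices and
   initial vectors), so everything is computed in [rat]. *)
From HB Require Import structures.
From mathcomp Require Import all_boot all_order all_algebra.
Unset Printing Implicit Defensive.
Import Order.TTheory GRing.Theory Num.Theory.

(* Read-only input tape  ¢ w $ : position 0 is ¢, positions 1..|w| hold w,
   position |w|+1 is $.                                                 *)
Inductive tsym (S : Type) := LEnd | REnd | Sym of S.
Arguments LEnd {S}. Arguments REnd {S}. Arguments Sym {S}.

Definition tape_at {S : Type} (w : seq S) (i : nat) : tsym S :=
  match i with
  | 0 => LEnd
  | i'.+1 => match drop i' w with x :: _ => Sym x | [::] => REnd end
  end.

Inductive move := MLeft | MStay | MRight.

(* head move on the input tape ¢w$ (positions 0 .. bound); the head never
   leaves the end-markers *)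
Definition move_in (bound : nat) (m : move) (p : nat) : nat :=
  match m with MLeft => p.-1 | MStay => p | MRight => minn p.+1 bound end.

Definition move_work (m : move) (p : nat) : nat :=
  match m with MLeft => p.-1 | MStay => p | MRight => p.+1 end.

Inductive kgsym := K0 | K1 | KAll | KEx | KLp | KRp | KComma.

Definition bits (s : seq bool) : seq kgsym := map (fun b : bool => if b then K1 else K0) s.
(* most significant bit first *)
Definition bitval (s : seq bool) : nat := foldl (fun a (b : bool) => (a.*2 + b)%N) 0%N s.

Definition enc_block (blk : seq bool * seq bool * seq bool * seq bool) : seq kgsym :=
  let: (a, b, e, f) := blk in
  KAll :: KLp :: bits a ++ KComma :: bits b ++ KRp ::
  KEx :: KLp :: bits e ++ KComma :: bits f ++ [:: KRp].

Definition enc_KG (S : seq bool) (blks : seq (seq bool * seq bool * seq bool * seq bool)) :=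
  bits S ++ flatten (map enc_block blks).

(* for every x in prod {a_i,b_i} there is y in prod {e_i,f_i} with
   S = sum_i (x_i + y_i); x (resp. y) is given by a choice vector of bools *)
Definition KG_game (S : nat) (q : seq (nat * nat * nat * nat)) : Prop :=
  forall x : seq bool, size x = size q ->
  exists y : seq bool, size y = size q /\
    S = (\sum_(i < size q)
           let: (a, b, e, f) := nth (0, 0, 0, 0)%N q i in
           ((if nth false x i then b else a) + (if nth false y i then f else e)))%N.

Definition LKG (w : seq kgsym) : Prop :=
  exists (S : seq bool) (blks : seq (seq bool * seq bool * seq bool * seq bool)),
    S != [::] /\
    all (fun blk : seq bool * seq bool * seq bool * seq bool =>
           let: (a, b, e, f) := blk in
           [&& a != [::], b != [::], e != [::] & f != [::]]) blks /\
    w = enc_KG S blks /\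
    KG_game (bitval S)
      (map (fun blk : seq bool * seq bool * seq bool * seq bool =>
              let: (a, b, e, f) := blk in (bitval a, bitval b, bitval e, bitval f)) blks).

(* Linear-space reductions: deterministic Turing transducers with a
   read-only two-way input tape ¢w$, one work tape, and a write-only
   one-way output tape.                                                 *)
Record lstm (S D : Type) := LSTM {
  mQ : finType;
  mG : finType;
  mblank : mG;
  mq0 : mQ;
  mhalt : pred mQ;
  (* state, input symbol, work symbol  |->
     new state, written work symbol, input move, work move, output symbol *)
  mdelta : mQ -> tsym S -> mG -> mQ * mG * move * move * option D;
  mc : nat
}.

Arguments mQ {S D}. Arguments mG {S D}. Arguments mblank {S D}. Arguments mq0 {S D}.
Arguments mhalt {S D}. Arguments mdelta {S D}. Arguments mc {S D}.

Record tmconf (S D : Type) (M : lstm S D) := TMConf {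
  cq : mQ M; cip : nat; ctape : nat -> mG M; cwp : nat; cout : seq D }.

Arguments TMConf {S D M}. Arguments cq {S D M}. Arguments cip {S D M}.
Arguments ctape {S D M}. Arguments cwp {S D M}. Arguments cout {S D M}.

Definition tm_init (S D : Type) (M : lstm S D) : tmconf S D M :=
  TMConf (mq0 M) 0 (fun _ => mblank M) 0 [::].

Definition tm_step (S D : Type) (M : lstm S D) (w : seq S) (c : tmconf S D M) : tmconf S D M :=
  if mhalt M (cq c) then c else
  let: (q', a, mi, mw, od) := mdelta M (cq c) (tape_at w (cip c)) (ctape c (cwp c)) in
  TMConf q' (move_in (size w).+1 mi (cip c))
    (fun i => if i == cwp c then a else ctape c i)
    (move_work mw (cwp c))
    (cout c ++ (if od is Some d then [:: d] else [::])).

Definition tm_run (S D : Type) (M : lstm S D) (w : seq S) (t : nat) : tmconf S D M :=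
  iter t (tm_step S D M w) (tm_init S D M).

Definition computes_linspace (S D : Type) (M : lstm S D) (f : seq S -> seq D) : Prop :=
  forall w : seq S,
    (exists T, mhalt M (cq (tm_run S D M w T)) /\ cout (tm_run S D M w T) = f w) /\
    (forall t, (cwp (tm_run S D M w t) < mc M * (size w).+1)%N).

Definition lin_space_reducible {S D : Type} (L : seq S -> Prop) (L' : seq D -> Prop) : Prop :=
  exists (M : lstm S D) (f : seq S -> seq D),
    computes_linspace S D M f /\ forall w, L w <-> L' (f w).

Local Open Scope ring_scope.

Record verifier (S : finType) := Verifier {
  vQ : finType;
  vG : finType;                       (* prover-to-verifier communication alphabet *)
  vr : nat;                           (* number of affine registers *)
  vdim : 'I_vr -> nat;
  vinit : forall k : 'I_vr, 'cV[rat]_(vdim k);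
  vq0 : vQ;
  vacc : pred vQ;
  vrej : pred vQ;
  (* for each register: Some M = apply affine operator M, None = weighting *)
  vop : vQ -> tsym S -> vG -> forall k : 'I_vr, option 'M[rat]_(vdim k);
  (* next state and head move, depending on the weighting outcomes
     (outcome of register k: Some j if weighted with result e_j, else None) *)
  vtr : vQ -> tsym S -> vG -> ('I_vr -> option nat) -> vQ * move
}.

Arguments vQ {S}. Arguments vG {S}. Arguments vr {S}. Arguments vdim {S}.
Arguments vinit {S}. Arguments vq0 {S}. Arguments vacc {S}. Arguments vrej {S}.
Arguments vop {S}. Arguments vtr {S}.

Definition affine_vec (n : nat) (v : 'cV[rat]_n) : bool := \sum_i v i 0 == 1.
Definition affine_op (n : nat) (M : 'M[rat]_n) : bool := [forall j, \sum_i M i j == 1].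

Definition wf_verifier (S : finType) (V : verifier S) : Prop :=
  (forall k, affine_vec _ (vinit V k)) /\
  (forall q s g k M, vop V q s g k = Some M -> affine_op _ M) /\
  (forall q, ~~ (vacc V q && vrej V q)).

Definition outcome {S : finType} (V : verifier S) := 'I_(vr V) -> option nat.

(* all-powerful prover: sees the whole history (its messages and all
   weighting outcomes, from which states and head moves are determined) *)
Definition prover {S : finType} (V : verifier S) :=
  seq (vG V * outcome V) -> vG V.

Definition wprob (n : nat) (v : 'cV[rat]_n) (j : nat) : rat :=
  (\sum_(i < n | val i == j) `|v i 0|) / (\sum_(i < n) `|v i 0|).

Definition basis (n : nat) (j : nat) : 'cV[rat]_n := \col_(i < n) ((val i == j)%:R).

Definition upd (I : eqType) (T : Type) (f : I -> T) (k : I) (x : T) : I -> T :=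
  fun k' => if k' == k then x else f k'.

Definition outcomes (S : finType) (V : verifier S)
    (regs : forall k, 'cV[rat]_(vdim V k)) (ops : forall k, option 'M[rat]_(vdim V k))
    : seq (rat * outcome V) :=
  foldr (fun k acc =>
           if ops k is None then
             flatten [seq [seq (po.1 * wprob _ (regs k) j, upd _ _ po.2 k (Some j))
                          | j <- iota 0 (vdim V k)] | po <- acc]
           else acc)
        [:: (1, fun _ => None)] (enum 'I_(vr V)).

Definition new_regs (S : finType) (V : verifier S)
    (regs : forall k, 'cV[rat]_(vdim V k)) (ops : forall k, option 'M[rat]_(vdim V k))
    (o : outcome V) : forall k, 'cV[rat]_(vdim V k) :=
  fun k => match ops k with Some M => M *m regs k | None => basis _ (odflt 0%N (o k)) end.

Fixpoint hprob (S : finType) (V : verifier S) (w : seq S) (P : prover V)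
    (target : pred (vQ V)) (t : nat) (q : vQ V) (pos : nat)
    (regs : forall k, 'cV[rat]_(vdim V k)) (hist : seq (vG V * outcome V)) {struct t} : rat :=
  if vacc V q || vrej V q then (target q)%:R else
  match t with
  | 0 => 0
  | t'.+1 =>
      let s := tape_at w pos in
      let g := P hist in
      let ops := vop V q s g in
      \sum_(po <- outcomes S V regs ops)
        po.1 * hprob S V w P target t' (vtr V q s g po.2).1
                 (move_in (size w).+1 (vtr V q s g po.2).2 pos)
                 (new_regs S V regs ops po.2) (rcons hist (g, po.2))
  end.

(* the probability of halting in [target] (the limit of hprob as t grows)
   is at least p *)
Definition halt_prob_ge (S : finType) (V : verifier S) (w : seq S) (P : prover V)
    (target : pred (vQ V)) (p : rat) : Prop :=
  forall d : rat, 0 < d ->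
    exists t, p - d <= hprob S V w P target t (vq0 V) 0 (vinit V) [::].

Definition verifies {S : finType} (V : verifier S) (L : seq S -> Prop) (eps : rat) : Prop :=
  wf_verifier S V /\
  (forall w, L w -> exists P : prover V, halt_prob_ge S V w P (vacc V) (1 - eps)) /\
  (forall w, ~ L w -> forall P : prover V, halt_prob_ge S V w P (vrej V) (1 - eps)).

Definition perfect_completeness {S : finType} (V : verifier S) (L : seq S -> Prop) : Prop :=
  forall w, L w -> exists P : prover V, halt_prob_ge S V w P (vacc V) 1.

(* Main.v *)
Require Import Defs.
From HB Require Import structures.
From mathcomp Require Import all_boot all_order all_algebra.
From mathcomp Require Import ring lra zify.
From mathcomp Require Import boolp filter.

(* The verifier works in rounds, in which it makes two passes over the output
   of the reduction, simulating the Turing machine with the help of the prover.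
   A configuration is a word aligned with the input tape; its value in base
   [base] is held in an affine register.  At every step the prover spells out
   the current configuration; the verifier compares its value with the one
   predicted by the previous step, while predicting the next value, which is
   linear in the letters once the scanned symbols are known.  The comparison
   puts (D / eps, - D / eps, 1) in a register, where D is the difference:
   observing the last basis state is certain if D = 0 and has probability at
   most eps / 2 if D is a nonzero integer.

   In the first pass coins choose x, in the second one the prover chooses y, and
   S - sum x - sum y is tested against 0 in the same way.  If the test succeeds,
   the verifier accepts only with a probability exponentially small in the
   number of coins, and otherwise starts a new round.  If w is not in L, some x
   is bad and is drawn with a probability larger than that of acceptance by a
   factor of order 1 / eps, so that each round increases the guaranteed
   probability of rejection by a fixed amount as long as it is below 1 - eps. *)

Set Implicit Arguments.
Unset Strict Implicit.
Unset Printing Implicit Defensive.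
Import Order.TTheory GRing.Theory Num.Theory.
Local Open Scope classical_set_scope.
Local Open Scope ring_scope.

(** * Preliminaries *)

Lemma descending_ind (P : nat -> Prop) n :
  P n -> (forall i, (i < n)%N -> P i.+1 -> P i) -> P 0%N.
Proof.
elim: n => // n IH Pn PS; apply: IH; first exact: PS.
by move=> i lt_in; apply: PS; rewrite ltnS ltnW.
Qed.

Lemma near_inftyS (A : nat -> Prop) :
  (\forall t \near \oo, A t.+1) -> \forall t \near \oo, A t.
Proof. by case=> N _ AN; exists N.+1 => // -[|t] //; exact: AN. Qed.

Lemma archimedean_climb (F : archiRealFieldType) (A : F -> Prop) (gain target : F) :
  0 < gain -> A 0 ->
  (forall v, A v -> 0 <= v -> v < target -> A (v + gain)) ->
  exists2 v, target <= v & A v.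
Proof.
move=> gain_gt0 A0 climb.
have climb_n n : (exists2 v, target <= v & A v) \/ A (gain *+ n).
  elim: n => [|n [?|An]]; [by right|by left|].
  have [le_t|lt_t] := lerP target (gain *+ n); first by left; exists (gain *+ n).
  by right; rewrite mulrSr; apply: climb; rewrite ?mulrn_wge0 // ltW.
pose n := Num.bound `|target / gain|.
have [] // := climb_n n => An; exists (gain *+ n) => //.
rewrite -mulr_natl -ler_pdivrMr //; apply: le_trans (ler_norm _) _.
exact/ltW/archi_boundP.
Qed.

Definition mix (F : realFieldType) (v v' : F) (k : nat) : F := v + (v' - v) / 2 ^+ k.

Section Mix.
Variables (F : realFieldType) (v v' : F).

Lemma mix0 : mix v v' 0 = v'.
Proof. by rewrite /mix expr0 divr1 addrC subrK. Qed.

Lemma mixS k : mix v v' k.+1 = (mix v v' k + v) / 2.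
Proof. by rewrite /mix exprS; field; rewrite expf_neq0 ?pnatr_eq0. Qed.

Lemma mix_bounds k : v <= v' -> v <= mix v v' k <= v'.
Proof.
move=> le_v; elim: k => [|k /andP[le_mix mix_le]]; first by rewrite mix0 le_v lexx.
by rewrite mixS; apply/andP; split; lra.
Qed.

End Mix.

(** * Affine registers with three basis states *)

Definition plane := (rat * rat)%type.

Record affine_map := AffineMap {
  axx : rat; axy : rat; ayx : rat; ayy : rat; tx : rat; ty : rat }.

Definition affine_app (f : affine_map) (p : plane) : plane :=
  (axx f * p.1 + axy f * p.2 + tx f, ayx f * p.1 + ayy f * p.2 + ty f).

Coercion affine_app : affine_map >-> Funclass.

Definition affine_id : affine_map := AffineMap 1 0 0 1 0 0.
Definition affine_const (p : plane) : affine_map := AffineMap 0 0 0 0 p.1 p.2.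
Definition affine_scale (r : rat) : affine_map := AffineMap r 0 0 r 0 0.
Definition affine_fst (r t : rat) : affine_map := AffineMap r 0 0 1 t 0.
Definition affine_snd (r t : rat) : affine_map := AffineMap 1 0 0 r 0 t.
Definition affine_subsnd : affine_map := AffineMap 1 (-1) 0 0 0 0.
Definition affine_opposites (r s : rat) : affine_map := AffineMap r s (- r) (- s) 0 0.

Lemma affine_idE p : affine_id p = p.
Proof. by case: p => x y; congr pair; rewrite /=; ring. Qed.

Lemma affine_constE p q : affine_const p q = p.
Proof. by case: p => x y; congr pair; rewrite /=; ring. Qed.

Lemma affine_scaleE r x y : affine_scale r (x, y) = (r * x, r * y).
Proof. by congr pair; rewrite /=; ring. Qed.

Lemma affine_fstE r t x y : affine_fst r t (x, y) = (r * x + t, y).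
Proof. by congr pair; rewrite /=; ring. Qed.

Lemma affine_sndE r t x y : affine_snd r t (x, y) = (x, r * y + t).
Proof. by congr pair; rewrite /=; ring. Qed.

Lemma affine_subsndE x y : affine_subsnd (x, y) = (x - y, 0).
Proof. by congr pair; rewrite /=; ring. Qed.

Lemma affine_oppositesE r s x y :
  affine_opposites r s (x, y) = (r * x + s * y, - (r * x + s * y)).
Proof. by congr pair; rewrite /=; ring. Qed.

Definition state_of (p : plane) : 'cV[rat]_3 :=
  \col_i nth 0 [:: p.1; p.2; 1 - p.1 - p.2] i.

(* As the coordinates of a state sum to 1, the translation part of [f] can be
   added to every column. *)
Definition operator_of (f : affine_map) : 'M[rat]_3 :=
  \matrix_(i, j)
    let u := nth 0 [:: axx f; axy f; 0] j + tx f in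
    let v := nth 0 [:: ayx f; ayy f; 0] j + ty f in
    nth 0 [:: u; v; 1 - u - v] i.

Lemma affine_vec_state_of p : affine_vec 3 (state_of p).
Proof. by apply/eqP; rewrite !big_ord_recl big_ord0 !mxE /=; ring. Qed.

Lemma affine_op_operator_of f : affine_op 3 (operator_of f).
Proof.
by apply/forallP=> j; apply/eqP; rewrite !big_ord_recl big_ord0 !mxE /=; ring.
Qed.

Lemma mulmx_operator_of f p : operator_of f *m state_of p = state_of (f p).
Proof.
apply/colP=> i; rewrite !mxE !big_ord_recl big_ord0 !mxE /=.
by case: i => -[|[|[|//]]] /= _; ring.
Qed.

Definition basis_point (j : nat) : plane := ((j == 0%N)%:R, (j == 1%N)%:R).

Lemma basis_state_of j : (j < 3)%N -> basis 3 j = state_of (basis_point j).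
Proof.
move=> lt_j; apply/colP=> i; rewrite !mxE /basis_point.
case: i => -[|[|[|//]]] ?; case: j lt_j => [|[|[|//]]] _ //=;
  by rewrite ?subr0 ?subrr ?sub0r.
Qed.

Lemma wprob_ge0 n v j : 0 <= wprob n v j.
Proof. by rewrite /wprob divr_ge0 // sumr_ge0. Qed.

Lemma sum_wprob n v : affine_vec n v -> \sum_(j < n) wprob n v j = 1.
Proof.
move=> /eqP sum_v; have norm_gt0 : 0 < \sum_i `|v i 0|.
  by apply: lt_le_trans (ler_norm_sum _ _ _); rewrite sum_v normr1.
rewrite -mulr_suml -[RHS](divff (lt0r_neq0 norm_gt0)); congr (_ / _).
by apply: eq_bigr => j _; rewrite (big_pred1 j).
Qed.

Definition last_prob (p : plane) : rat := wprob 3 (state_of p) 2.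

Lemma last_prob_ge0 p : 0 <= last_prob p.
Proof. exact: wprob_ge0. Qed.

Lemma last_probC p : wprob 3 (state_of p) 0 + wprob 3 (state_of p) 1 = 1 - last_prob p.
Proof.
rewrite -(sum_wprob (affine_vec_state_of p)) !big_ord_recr big_ord0 /=.
by rewrite add0r addrK.
Qed.

Lemma last_prob_le1 p : last_prob p <= 1.
Proof. by rewrite -subr_ge0 -last_probC addr_ge0 ?wprob_ge0. Qed.

Lemma last_prob_opposites x : last_prob (x, - x) = (1 + 2 * `|x|)^-1.
Proof.
rewrite /last_prob /wprob big_mkcond /= !big_ord_recl !big_ord0 !mxE /=.
rewrite normrN opprK addrNK normr1 !add0r addr0 mul1r; congr _^-1; ring.
Qed.

Lemma last_prob_half : last_prob (1 / 2, 0) = 1 / 2.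
Proof.
by rewrite /last_prob /wprob big_mkcond /= !big_ord_recl !big_ord0 !mxE.
Qed.

(** * Weighting outcomes and halting probabilities of a verifier *)

Section Verifier.
Variables (S : finType) (V : verifier S).
Implicit Types (regs : forall k, 'cV[rat]_(vdim V k)).
Implicit Types (ops : forall k, option 'M[rat]_(vdim V k)).

Lemma outcomes_no_weighting regs ops : (forall k, ops k) ->
  outcomes S V regs ops = [:: (1, fun=> None)].
Proof.
move=> some_ops; rewrite /outcomes; elim: (enum _) => //= k l ->.
by case: (ops k) (some_ops k).
Qed.

Lemma outcomes_one_weighting regs ops k0 : ~~ ops k0 -> (forall k, k != k0 -> ops k) ->
  outcomes S V regs ops =
  [seq (wprob _ (regs k0) j, upd _ _ (fun=> None) k0 (Some j)) | j <- iota 0 (vdim V k0)].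
Proof.
move=> none_k0 some_ops; rewrite /outcomes.
have : k0 \in enum 'I_(vr V) by rewrite mem_enum.
have := enum_uniq 'I_(vr V); elim: (enum _) => //= k l IH /andP[kNl ul].
rewrite in_cons eq_sym; have [Ek _|nk /= kl] := eqVneq k k0; last first.
  by rewrite IH //; case: (ops k) (some_ops k nk).
rewrite (_ : foldr _ _ _ = [:: (1, fun=> None)]).
  rewrite {}Ek; case: (ops k0) none_k0 => //= _; rewrite cats0.
  by apply: eq_map => j; rewrite mul1r.
rewrite Ek in kNl; elim: l kNl {IH ul} => //= k' l IH.
rewrite in_cons negb_or eq_sym => /andP[nk' /IH ->].
by case: (ops k') (some_ops k' nk').
Qed.

Lemma outcomes_prob_ge0 regs ops : all (fun po => 0 <= po.1) (outcomes S V regs ops).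
Proof.
rewrite /outcomes; elim: (enum _) => //= k l IH; case: (ops k) => //.
elim: (foldr _ _ _) IH => //= po acc IH /andP[po_ge0 /IH acc_ge0].
rewrite all_cat acc_ge0 andbT all_map; apply/allP => j _ /=.
by rewrite mulr_ge0 ?wprob_ge0.
Qed.

Variables (w : seq S) (P : prover V) (target : pred (vQ V)).

Lemma hprob_ge0 t q pos regs hist : 0 <= hprob S V w P target t q pos regs hist.
Proof.
elim: t q pos regs hist => [|t IH] q pos regs hist /=; case: ifP => // _.
set os := outcomes _ _ _ _; have /all_filterP <- : all (fun po => 0 <= po.1) os.
  exact: outcomes_prob_ge0.
by rewrite big_filter sumr_ge0 // => po po_ge0; rewrite mulr_ge0.
Qed.

End Verifier.

(** * Programs *)

Section Program.
Variables (S Q G R : finType) (q0 : Q) (acc rej : pred Q).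

(* [Weigh k qy qn] continues in [qy] when the last basis state of register [k]
   is observed, and in [qn] otherwise. *)
Inductive instr := Op of (R -> affine_map) & Q & move | Weigh of R & Q & Q.

Variable prog : Q -> tsym S -> G -> instr.

Definition prog_verifier : verifier S :=
  @Verifier S Q G #|R| (fun=> 3) (fun=> state_of (0, 0)) q0 acc rej
    (fun q s g k => match prog q s g with
       | Op f _ _ => Some (operator_of (f (enum_val k)))
       | Weigh k0 _ _ => if enum_val k == k0 then None else Some (operator_of affine_id)
       end)
    (fun q s g o => match prog q s g with
       | Op _ q' mv => (q', mv)
       | Weigh k qy qn => (if o (enum_rank k) == Some 2 then qy else qn, MStay)
       end).

Local Notation V := prog_verifier.

Lemma wf_prog_verifier : (forall q, ~~ (acc q && rej q)) -> wf_verifier S V.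
Proof.
move=> acc_rej; split; first by move=> k; exact: affine_vec_state_of.
split; last exact: acc_rej.
move=> q s g k M /=; case: (prog q s g) => [f ? ?|k0 ? ?].
  by case=> <-; exact: affine_op_operator_of.
by case: (_ == k0) => // -[<-]; exact: affine_op_operator_of.
Qed.

Record conf := Conf { st : Q; hd : nat; rg : R -> plane }.

Definition running (c : conf) : bool := ~~ (acc (st c) || rej (st c)).

Variable w : seq S.

Definition instr_at (c : conf) (g : G) : instr := prog (st c) (tape_at w (hd c)) g.

Definition apply_op (c : conf) (f : R -> affine_map) (q : Q) (mv : move) : conf :=
  Conf q (move_in (size w).+1 mv (hd c)) (fun k => f k (rg c k)).

Definition observe (c : conf) (k : R) (q : Q) (j : nat) : conf :=
  Conf q (hd c) (upd _ _ (rg c) k (basis_point j)).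

Definition observed (k : R) (j : nat) : outcome V :=
  upd _ _ (fun=> None) (enum_rank k) (Some j).

Definition states_of (z : R -> plane) (k : 'I_(vr V)) : 'cV[rat]_(vdim V k) :=
  state_of (z (enum_val k)).

Definition halt_prob (P : prover V) (target : pred Q) (t : nat) (c : conf)
    (hist : seq (G * outcome V)) : rat :=
  hprob S V w P target t (st c) (hd c) (states_of (rg c)) hist.

Lemma halt_prob_ge0 P target t c hist : 0 <= halt_prob P target t c hist.
Proof. exact: hprob_ge0. Qed.

Lemma halt_prob_halted P target t c hist : ~~ running c ->
  halt_prob P target t c hist = (target (st c))%:R.
Proof. by rewrite negbK /halt_prob; case: t => [|t] /= ->. Qed.

Lemma halt_prob_op P target t c hist f q mv : running c ->
  instr_at c (P hist) = Op f q mv ->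
  halt_prob P target t.+1 c hist =
  halt_prob P target t (apply_op c f q mv) (rcons hist (P hist, fun=> None)).
Proof.
rewrite /instr_at => /negPf run_c instr_c; rewrite /halt_prob /= run_c instr_c.
rewrite outcomes_no_weighting // big_seq1 mul1r.
congr (hprob _ _ _ _ _ _ _ _ _ _); apply: functional_extensionality_dep => k.
exact: mulmx_operator_of.
Qed.

Lemma halt_prob_weigh P target t c hist k qy qn : running c ->
  instr_at c (P hist) = Weigh k qy qn ->
  halt_prob P target t.+1 c hist =
  \sum_(j <- iota 0 3) wprob 3 (state_of (rg c k)) j *
    halt_prob P target t (observe c k (if j == 2%N then qy else qn) j)
      (rcons hist (P hist, observed k j)).
Proof.
rewrite /instr_at => /negPf run_c instr_c; rewrite /halt_prob /= run_c instr_c.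
have enum_valE (k' : 'I_#|R|) : (enum_val k' == k) = (k' == enum_rank k).
  by rewrite -(can_eq enum_valK) enum_rankK.
rewrite (@outcomes_one_weighting _ V _ _ (enum_rank k)); first last.
- by move=> k' /negPf nk'; rewrite enum_valE nk'.
- by rewrite enum_valE eqxx.
rewrite big_map; apply: eq_big_seq => j; rewrite mem_iota => /= lt_j3.
rewrite /states_of enum_rankK /upd eqxx.
congr (_ * hprob _ _ _ _ _ _ _ _ _ _).
apply: functional_extensionality_dep => k'; rewrite /new_regs enum_valE.
by case: eqP => [->|_]; rewrite ?eqxx ?basis_state_of // mulmx_operator_of affine_idE.
Qed.

Definition weigh_mean (z : plane) (vy vn : rat) : rat :=
  last_prob z * vy + (1 - last_prob z) * vn.

Lemma halt_prob_weigh_ge P target t c hist k qy qn vy vn : running c ->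
  instr_at c (P hist) = Weigh k qy qn ->
  vy <= halt_prob P target t (observe c k qy 2) (rcons hist (P hist, observed k 2)) ->
  (last_prob (rg c k) < 1 -> forall j, (j < 2)%N ->
    vn <= halt_prob P target t (observe c k qn j) (rcons hist (P hist, observed k j))) ->
  weigh_mean (rg c k) vy vn <= halt_prob P target t.+1 c hist.
Proof.
move=> run_c instr_c le_vy le_vn; rewrite (halt_prob_weigh _ _ run_c instr_c).
rewrite !big_cons big_nil addr0 addrA addrC /weigh_mean /=.
apply: lerD; first by rewrite ler_wpM2l ?last_prob_ge0.
have [p_lt1|] := ltP (last_prob (rg c k)) 1.
  by rewrite -last_probC mulrDl; apply: lerD; rewrite ler_wpM2l ?wprob_ge0 ?le_vn.
rewrite le_eqVlt ltNge last_prob_le1 orbF => /eqP <-.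
by rewrite subrr mul0r addr_ge0 // mulr_ge0 ?wprob_ge0 ?halt_prob_ge0.
Qed.

Definition rejects_ge (c : conf) (v : rat) : Prop :=
  \forall t \near \oo, forall P hist, v <= halt_prob P rej t c hist.

Lemma rejects_ge_le c v v' : v <= v' -> rejects_ge c v' -> rejects_ge c v.
Proof.
rewrite /rejects_ge => le_vv' near_v'; apply: (filterS _ near_v') => t vP P hist.
exact: le_trans le_vv' (vP _ _).
Qed.

Lemma rejects_ge0 c v : v <= 0 -> rejects_ge c v.
Proof.
by move=> v_le0; apply: nearW => t P hist; apply: le_trans v_le0 (halt_prob_ge0 _ _ _ _ _).
Qed.

Lemma rejects_ge_rej c v : rej (st c) -> v <= 1 -> rejects_ge c v.
Proof.
move=> rej_c v_le1; apply: nearW => t P hist.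
by rewrite halt_prob_halted /running ?rej_c ?orbT.
Qed.

Lemma rejects_ge_step c v : running c ->
  (forall g, match instr_at c g with
   | Op f q mv => rejects_ge (apply_op c f q mv) v
   | Weigh k qy qn => exists vy vn, [/\ rejects_ge (observe c k qy 2) vy,
       forall j, (j < 2)%N -> rejects_ge (observe c k qn j) vn
     & v <= weigh_mean (rg c k) vy vn]
   end) -> rejects_ge c v.
Proof.
rewrite /rejects_ge => run_c step_c; apply: near_inftyS.
suff near_all : \forall t \near \oo,
    forall g (P : prover V) hist, P hist = g -> v <= halt_prob P rej t.+1 c hist.
  by apply: (filterS _ near_all) => t vP P hist; exact: vP erefl.
apply: filter_forall => g.
move: (step_c g); case instr_c: (instr_at c g) => [f q mv|k qy qn].
  move=> near_v; apply: (filterS _ near_v) => t vP P hist Pg; rewrite -Pg in instr_c.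
  by rewrite (halt_prob_op _ _ run_c instr_c).
case=> vy [vn [near_y near_n le_v]].
apply: (filterS3 _ _ near_y (near_n 0%N isT) (near_n 1%N isT)) => t le_y le_n0 le_n1.
move=> P hist Pg; rewrite -Pg in instr_c; apply: le_trans le_v _.
by apply: halt_prob_weigh_ge instr_c _ _ => // _ [|[|]].
Qed.

Lemma rejects_ge_weigh c k qy qn v : running c ->
  (forall g, instr_at c g = Weigh k qy qn) -> rejects_ge (observe c k qy 2) v ->
  (forall j, (j < 2)%N -> rejects_ge (observe c k qn j) v) -> rejects_ge c v.
Proof.
move=> run_c instr_c rej_y rej_n; apply: rejects_ge_step => // g; rewrite instr_c.
by exists v, v; split=> //; rewrite /weigh_mean -mulrDl addrC subrK mul1r.
Qed.

Lemma rejects_ge_test c k qy qn v : running c ->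
  (forall g, instr_at c g = Weigh k qy qn) -> rej qn -> last_prob (rg c k) <= 1 - v ->
  rejects_ge c v.
Proof.
move=> run_c instr_c rej_qn le_v; apply: rejects_ge_step => // g; rewrite instr_c.
exists 0, 1; split=> [|j _|]; [exact: rejects_ge0|exact: rejects_ge_rej|].
by rewrite /weigh_mean; lra.
Qed.

Record closed (W : conf -> Prop) : Prop := Closed {
  closed_op : forall c f q mv, running c -> (forall g, instr_at c g = Op f q mv) ->
    W (apply_op c f q mv) -> W c;
  closed_sure : forall c k qy qn, running c -> (forall g, instr_at c g = Weigh k qy qn) ->
    last_prob (rg c k) = 1 -> W (observe c k qy 2) -> W c }.

Lemma closed_rejects_ge v : closed (rejects_ge^~ v).
Proof.
split=> [c f q mv run_c instr_c W_c|c k qy qn run_c instr_c sure W_c];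
  apply: rejects_ge_step => // g; rewrite instr_c //.
exists v, 0; split=> //; first by move=> j _; apply: rejects_ge0.
by rewrite /weigh_mean sure subrr mul0r mul1r addr0.
Qed.

Section Strategy.
Variable goal : conf -> Prop.

Definition safe_message (W : conf -> Prop) (c : conf) (g : G) : Prop :=
  match instr_at c g with
  | Op f q mv => W (apply_op c f q mv)
  | Weigh k qy qn => W (observe c k qy 2) /\
      (last_prob (rg c k) < 1 -> forall j, (j < 2)%N -> W (observe c k qn j))
  end.

Fixpoint reach (n : nat) (c : conf) : Prop :=
  goal c \/
  (if n is n'.+1 then running c /\ exists g, safe_message (reach n') c g else False).

Definition safe (c : conf) : Prop := \forall n \near \oo, reach n c.

Lemma safe_goal c : goal c -> safe c.
Proof. by move=> goal_c; apply: nearW => -[|n]; left. Qed.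

Lemma safe_cons c g : running c -> safe_message safe c g -> safe c.
Proof.
rewrite /safe => run_c safe_g; apply: near_inftyS.
suff near_g : \forall n \near \oo, safe_message (reach n) c g.
  by apply: (filterS _ near_g) => n reach_n; right; split=> //; exists g.
move: safe_g; rewrite /safe_message; case: instr_at => [f q mv //|k qy qn [near_y near_n]].
have [p_lt1|_] := boolP (last_prob (rg c k) < 1); last first.
  by apply: (filterS _ near_y) => n reach_y; split.
apply: (filterS3 _ _ near_y (near_n p_lt1 0%N isT) (near_n p_lt1 1%N isT)).
by move=> n reach_y reach0 reach1; split=> // _ [|[|]].
Qed.

Lemma closed_safe : G -> closed safe.
Proof.
move=> g; split=> [c f q mv run_c instr_c W_c|c k qy qn run_c instr_c sure W_c];
  by apply: (safe_cons (g := g)) => //; rewrite /safe_message instr_c // sure ltxx.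
Qed.

Definition level (c : conf) (n : nat) : Prop :=
  reach n c /\ forall m, reach m c -> (n <= m)%N.

Lemma reach_level n c : reach n c -> exists2 m, (m <= n)%N & level c m.
Proof.
move=> reach_n; have ex_n : exists m, `[< reach m c >] by exists n; apply/asboolP.
case: (ex_minnP ex_n) => m /asboolP reach_m min_m.
by exists m; [exact/min_m/asboolP|split=> // k /asboolP/min_m].
Qed.

(* Descending along a minimal level makes a positional strategy terminate. *)
Lemma level_strategy : G -> exists sigma : conf -> G,
  forall c n, level c n.+1 -> safe_message (reach n) c (sigma c).
Proof.
move=> g0; suff /choice[sigma sigmaP] : forall c, exists g, forall n,
    level c n.+1 -> safe_message (reach n) c g by exists sigma.
move=> c; have [[n [reach_n min_n]]|no_level] := EM (exists n, level c n.+1); last first.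
  by exists g0 => n level_n; case: no_level; exists n.
case: (reach_n) => [goal_c|[_ [g safe_g]]]; first by have := min_n 0%N (or_introl goal_c).
exists g => m [reach_m min_m]; suff -> : m = n by [].
by apply/eqP; rewrite eqn_leq -ltnS min_m // -ltnS min_n.
Qed.

Definition retriable (alpha : rat) : Prop := forall c, goal c -> running c /\
  exists k qy qn, [/\ forall g, instr_at c g = Weigh k qy qn, acc qy,
    last_prob (rg c k) = alpha & forall j, (j < 2)%N -> safe (observe c k qn j)].

Variables (alpha : rat) (c0 : conf) (sigma : conf -> G).
Hypothesis alpha_gt0 : 0 < alpha.
Hypothesis retry : retriable alpha.
Hypothesis sigmaP : forall c n, level c n.+1 -> safe_message (reach n) c (sigma c).

Definition next (c : conf) (go : G * outcome V) : conf :=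
  match instr_at c go.1 with
  | Op f q mv => apply_op c f q mv
  | Weigh k qy qn =>
      let j := odflt 0%N (go.2 (enum_rank k)) in
      observe c k (if j == 2%N then qy else qn) j
  end.

Definition current (hist : seq (G * outcome V)) : conf := foldl next c0 hist.

Definition strategy_prover : prover V := fun hist => sigma (current hist).

Lemma current_op hist f q mv (g := strategy_prover hist) (c := current hist) :
  instr_at c g = Op f q mv ->
  current (rcons hist (g, fun=> None)) = apply_op c f q mv.
Proof. by rewrite /current foldl_rcons /next => ->. Qed.

Lemma current_weigh hist k qy qn j (g := strategy_prover hist) (c := current hist) :
  instr_at c g = Weigh k qy qn ->
  current (rcons hist (g, observed k j)) = observe c k (if j == 2%N then qy else qn) j.
Proof. by rewrite /current foldl_rcons /next /= => ->; rewrite /observed /upd eqxx. Qed.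

Definition accepts_ge (v : rat) : Prop := forall hist, safe (current hist) ->
  \forall t \near \oo, v <= halt_prob strategy_prover acc t (current hist) hist.

Lemma near_accepts_weigh hist k qy qn vy vn (g := strategy_prover hist) (c := current hist)
    (later := fun j => rcons hist (g, observed k j)) :
  running c -> instr_at c g = Weigh k qy qn ->
  (\forall t \near \oo,
     vy <= halt_prob strategy_prover acc t (current (later 2)) (later 2)) ->
  (last_prob (rg c k) < 1 -> forall j, (j < 2)%N -> \forall t \near \oo,
     vn <= halt_prob strategy_prover acc t (current (later j)) (later j)) ->
  \forall t \near \oo, weigh_mean (rg c k) vy vn <= halt_prob strategy_prover acc t c hist.
Proof.
move=> run_c instr_c near_y near_n; apply: near_inftyS.
have near_other j : (j < 2)%N -> \forall t \near \oo, last_prob (rg c k) < 1 ->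
    vn <= halt_prob strategy_prover acc t (observe c k qn j) (later j).
  move=> lt_j2; have [p_lt1|_] := boolP (last_prob (rg c k) < 1); last exact: nearW.
  have near_j := near_n p_lt1 j lt_j2; apply: (filterS _ near_j) => t + _.
  by rewrite (current_weigh _ instr_c) (ltn_eqF lt_j2).
rewrite (current_weigh _ instr_c) /= in near_y.
apply: (filterS3 _ _ near_y (near_other 0%N isT) (near_other 1%N isT)) => t le_y le0 le1.
apply: halt_prob_weigh_ge instr_c le_y _ => // p_lt1 [|[|//]] _; first exact: le0.
exact: le1.
Qed.

Lemma near_accepts_goal v hist : accepts_ge v -> goal (current hist) ->
  \forall t \near \oo,
    alpha + (1 - alpha) * v <= halt_prob strategy_prover acc t (current hist) hist.
Proof.
move=> acc_v /retry[run_c [k [qy [qn [instr_c acc_qy <- safe_n]]]]].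
rewrite -[X in X + _]mulr1; apply: near_accepts_weigh (instr_c _) _ _ => //.
  apply: nearW => t; rewrite (current_weigh _ (instr_c _)) halt_prob_halted /= ?acc_qy //.
  by rewrite /running /= acc_qy.
move=> _ j lt_j2; apply: acc_v.
by rewrite (current_weigh _ (instr_c _)) (ltn_eqF lt_j2); apply: safe_n.
Qed.

Lemma accepts_ge_retry v : accepts_ge v -> accepts_ge (alpha + (1 - alpha) * v).
Proof.
move=> acc_v hist safe_hist; have [n] := filter_ex safe_hist.
elim/ltn_ind: n hist {safe_hist} => n IH hist /reach_level[[|m] le_mn level_m].
  by case: level_m => -[goal_c _|[]]; apply: near_accepts_goal.
have := sigmaP level_m; rewrite -[sigma _]/(strategy_prover hist) /safe_message.
have run_c : running (current hist).
  by case: level_m => -[goal_c /(_ 0%N (or_introl goal_c))|[]].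
case instr_c: instr_at => [f q mv|k qy qn].
  rewrite -(current_op instr_c) => reach_m; apply: near_inftyS.
  apply: (filterS _ (IH m le_mn _ reach_m)) => t.
  by rewrite (halt_prob_op _ _ run_c instr_c) (current_op instr_c).
case=> reach_y reach_n; set u := alpha + _.
have -> : u = weigh_mean (rg (current hist) k) u u by rewrite /weigh_mean; ring.
apply: (near_accepts_weigh run_c instr_c).
  by apply: (IH m) => //; rewrite (current_weigh _ instr_c).
move=> p_lt1 j lt_j2; apply: (IH m) => //.
by rewrite (current_weigh _ instr_c) (ltn_eqF lt_j2); apply: reach_n.
Qed.

Lemma strategy_accepts : safe c0 -> forall d, 0 < d ->
  exists t, 1 - d <= halt_prob strategy_prover acc t c0 [::].
Proof.
move=> safe0 d d_gt0.
have [v le_v acc_v] : exists2 v, 1 - d <= v & accepts_ge v; last first.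
  have [t le_t] := filter_ex (acc_v [::] safe0).
  by exists t; apply: le_trans le_v le_t.
apply: (@archimedean_climb _ accepts_ge (alpha * d)); first exact: mulr_gt0.
  by move=> hist _; apply: nearW => t; exact: halt_prob_ge0.
move=> v acc_v v_ge0 lt_v hist safe_c.
apply: (filterS _ (accepts_ge_retry acc_v safe_c)) => t; apply: le_trans.
have -> : alpha + (1 - alpha) * v = v + alpha * (1 - v) by ring.
by rewrite lerD2l ler_pM2l //; lra.
Qed.

End Strategy.

Definition start_conf : conf := Conf q0 0 (fun=> (0, 0)).

Lemma rejects_ge_halt_prob v : rejects_ge start_conf v ->
  forall P, halt_prob_ge S V w P (vrej V) v.
Proof.
move=> rej_v P d d_gt0; have [t le_v] := filter_ex rej_v.
by exists t; apply: le_trans (le_v P [::]); rewrite lerBlDr lerDl ltW.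
Qed.

Lemma safe_halt_prob (goal : conf -> Prop) (alpha : rat) : G -> 0 < alpha ->
  retriable goal alpha -> safe goal start_conf ->
  exists P, halt_prob_ge S V w P (vacc V) 1.
Proof.
move=> g0 alpha_gt0 retry safe0; have [sigma sigmaP] := level_strategy goal g0.
by exists (strategy_prover start_conf sigma); exact: strategy_accepts retry sigmaP safe0.
Qed.

End Program.

Arguments closed_rejects_ge {S Q G R q0 acc rej prog w}.
Arguments closed_safe {S Q G R acc rej prog w goal}.

(** * The knapsack game as a nondeterministic parser *)

(* In [Digits ex snd ne ch], the digits of the first or second ([snd]) number of
   a universal or existential ([ex]) pair are being read; [ne] records that a
   digit was read and [ch] which number of the pair was chosen. *)
Inductive pstate :=
  | Start_sum | In_sum | Open of bool | Digits of bool & bool & bool & bool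
  | After_all | After_ex | Syntax_error.

Definition pstate_code (p : pstate) : (bool * bool * bool * bool + bool) + 'I_5 :=
  match p with
  | Digits ex snd ne ch => inl (inl (ex, snd, ne, ch))
  | Open ex => inl (inr ex)
  | Start_sum => inr (@Ordinal 5 0 isT)
  | In_sum => inr (@Ordinal 5 1 isT)
  | After_all => inr (@Ordinal 5 2 isT)
  | After_ex => inr (@Ordinal 5 3 isT)
  | Syntax_error => inr (@Ordinal 5 4 isT)
  end.

Definition pstate_decode (x : (bool * bool * bool * bool + bool) + 'I_5) : pstate :=
  match x with
  | inl (inl (ex, snd, ne, ch)) => Digits ex snd ne ch
  | inl (inr ex) => Open ex
  | inr i => nth Syntax_error [:: Start_sum; In_sum; After_all; After_ex] i
  end.

Lemma pstate_codeK : cancel pstate_code pstate_decode.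
Proof. by case. Qed.

HB.instance Definition _ := Finite.copy pstate (can_type pstate_codeK).

Definition after_pair (ex : bool) : pstate := if ex then After_ex else After_all.

Definition pnext (c : bool) (p : pstate) (d : kgsym) : pstate :=
  match p, d with
  | Start_sum, (K0 | K1) | In_sum, (K0 | K1) => In_sum
  | In_sum, KAll | After_ex, KAll => Open false
  | After_all, KEx => Open true
  | Open ex, KLp => Digits ex false false c
  | Digits ex snd _ ch, (K0 | K1) => Digits ex snd true ch
  | Digits ex false true ch, KComma => Digits ex true false ch
  | Digits ex true true _, KRp => after_pair ex
  | _, _ => Syntax_error
  end.

Definition pfinal (p : pstate) : bool :=
  match p with In_sum | After_ex => true | _ => false end.

Definition is_one (d : kgsym) : rat := if d is K1 then 1 else 0.

(* The two coordinates are the total and the number being read.  In pass [m],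
   the chosen numbers of the pairs quantified in that pass are subtracted from
   the total; the target sum enters it in the universal pass only. *)
Definition parith (m : bool) (p : pstate) (d : kgsym) : affine_map :=
  match p, d with
  | Start_sum, (K0 | K1) | In_sum, (K0 | K1) =>
      if m then affine_id else affine_fst 2 (is_one d)
  | Digits _ _ _ _, (K0 | K1) => affine_snd 2 (is_one d)
  | Digits ex snd _ ch, (KComma | KRp) =>
      if (ex == m) && (snd == ch) then affine_subsnd else affine_snd 0 0
  | _, _ => affine_id
  end.

Definition kgstate := (pstate * plane)%type.

Definition kgstep (m c : bool) (d : kgsym) (x : kgstate) : kgstate :=
  (pnext c x.1 d, parith m x.1 d x.2).

Fixpoint kgrun (m : bool) (o : seq kgsym) (x y : kgstate) : Prop :=
  if o is d :: o' then exists c, kgrun m o' (kgstep m c d x) y else x = y.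

Definition kgstep_opt (m c : bool) (d : option kgsym) (x : kgstate) : kgstate :=
  if d is Some e then kgstep m c e x else x.

Lemma kgrun_emission m d o x y :
  kgrun m (seq_of_opt d ++ o) x y <-> exists c, kgrun m o (kgstep_opt m c d x) y.
Proof. by case: d => [d|] //=; split=> [run_x|[]//]; exists true. Qed.

Lemma kgrun_total m o x : exists y, kgrun m o x y.
Proof.
elim: o x => [|d o IH] x; first by exists x.
by have [y run_y] := IH (kgstep m true d x); exists y, true.
Qed.

Lemma kgrun_cons m d o x x' y : (forall c, kgstep m c d x = x') ->
  kgrun m (d :: o) x y <-> kgrun m o x' y.
Proof.
by move=> step_x; split=> [[c]|run_y]; [|exists true]; rewrite step_x.
Qed.

Definition int_coords (v : plane) : bool := (v.1 \is a Num.int) && (v.2 \is a Num.int).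

Lemma parith_int m p d v : int_coords v -> int_coords (parith m p d v).
Proof.
case: v => x y /andP[/= x_int y_int]; apply/andP.
case: p => [||ex|ex snd ne ch|||]; case: d; case: m; split=> /=; try case: ifP => _ /=;
  by rewrite ?rpredD ?rpredM ?rpredN ?rpred0 ?rpred1 ?rpred_nat.
Qed.

Lemma kgrun_int m o x y : kgrun m o x y -> int_coords x.2 -> int_coords y.2.
Proof.
by elim: o x => [|d o IH] x /=; [move=> ->|case=> c /IH{}IH x_int; apply/IH/parith_int].
Qed.

Definition binary_from (x : rat) (s : seq bool) : rat :=
  foldl (fun v (b : bool) => 2 * v + b%:R) x s.

Lemma binary_from0 s : binary_from 0 s = (bitval s)%:R.
Proof.
rewrite -[0]/(0%N%:R) /bitval; elim: s 0%N => //= b s IH n.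
by rewrite -IH -muln2 natrD natrM mulrC.
Qed.

Lemma kgrun_number m a o ex snd ne ch x v y :
  kgrun m (bits a ++ o) (Digits ex snd ne ch, (x, v)) y <->
  kgrun m o (Digits ex snd (ne || (a != [::])) ch, (x, binary_from v a)) y.
Proof.
elim: a v ne => [|b a IH] v ne /=; first by rewrite orbF.
rewrite orbT -[true]/(true || (a != [::])) -IH; apply: kgrun_cons => c.
by case: b; case: snd {IH}; case: ne; rewrite /kgstep [parith _ _ _]/= affine_sndE.
Qed.

Lemma kgrun_sum m a o p x y : p = In_sum \/ p = Start_sum /\ a != [::] ->
  kgrun m (bits a ++ o) (p, (x, 0)) y <->
  kgrun m o (In_sum, (if m then x else binary_from x a, 0)) y.
Proof.
elim: a p x => [|b a IH] p x sum_p; first by case: sum_p => [->|[]//]; case: m.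
pose x' := if m then x else 2 * x + b%:R.
have -> : (if m then x else binary_from x (b :: a)) = if m then x' else binary_from x' a.
  by rewrite /x'; case: (m).
rewrite -(IH In_sum); last by left.
by apply: kgrun_cons => c; rewrite /kgstep /x' {x'};
  case: sum_p => [|[]] ->; case: b; case: (m);
  rewrite [parith _ _ _]/= ?affine_idE ?affine_fstE.
Qed.

Definition enc_pair (a b : seq bool) : seq kgsym :=
  KLp :: bits a ++ KComma :: bits b ++ [:: KRp].

Lemma enc_block_pairs a b e f :
  enc_block (a, b, e, f) = KAll :: enc_pair a b ++ KEx :: enc_pair e f.
Proof. by rewrite /enc_block /enc_pair /= -!(catA, cat_cons). Qed.

Lemma parith_separator m ex snd ne ch d x z : d = KComma \/ d = KRp ->
  parith m (Digits ex snd ne ch) d (x, z) =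
  (if (ex == m) && (snd == ch) then x - z else x, 0).
Proof.
by case=> -> /=; case: ifP => _; rewrite ?affine_subsndE ?affine_sndE ?mul0r ?addr0.
Qed.

Lemma kgrun_pair m ex a b o x y : a != [::] -> b != [::] ->
  kgrun m (enc_pair a b ++ o) (Open ex, (x, 0)) y <->
  exists c, kgrun m o
    (after_pair ex, (if ex == m then x - (bitval (if c then b else a))%:R else x, 0)) y.
Proof.
move=> a0 b0; rewrite /enc_pair /= -!(catA, cat_cons).
have opened c : kgstep m c KLp (Open ex, (x, 0)) = (Digits ex false false c, (x, 0)).
  by rewrite /kgstep /= affine_idE.
have comma c ch z : kgstep m c KComma (Digits ex false true ch, (x, z)) =
    (Digits ex true false ch, (if (ex == m) && ~~ ch then x - z else x, 0)).
  by rewrite /kgstep parith_separator; [case: ch|left].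
have paren c ch z v : kgstep m c KRp (Digits ex true true ch, (z, v)) =
    (after_pair ex, (if (ex == m) && ch then z - v else z, 0)).
  by rewrite /kgstep parith_separator; [case: ch|right].
suff run_choice c : kgrun m (bits a ++ KComma :: bits b ++ KRp :: o)
      (Digits ex false false c, (x, 0)) y <->
    kgrun m o
      (after_pair ex, (if ex == m then x - (bitval (if c then b else a))%:R else x, 0)) y.
  by split=> -[c run_c]; exists c; move: run_c; rewrite opened => /run_choice.
rewrite kgrun_number a0 (kgrun_cons _ _ (fun c' => comma c' c (binary_from 0 a))).
rewrite kgrun_number b0 (kgrun_cons _ _ (fun c' => paren c' c _ (binary_from 0 b))).
by rewrite !binary_from0; case: (ex == m); case: c.
Qed.

Definition block := (seq bool * seq bool * seq bool * seq bool)%type.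

Definition wf_block (blk : block) : bool :=
  let: (a, b, e, f) := blk in [&& a != [::], b != [::], e != [::] & f != [::]].

Definition selected (m c : bool) (blk : block) : nat :=
  let: (a, b, e, f) := blk in
  bitval (if m then (if c then f else e) else (if c then b else a)).

Lemma kgrun_block m blk o p x y : pfinal p -> wf_block blk ->
  kgrun m (enc_block blk ++ o) (p, (x, 0)) y <->
  exists c, kgrun m o (After_ex, (x - (selected m c blk)%:R, 0)) y.
Proof.
case: blk => [[[a b] e] f] final_p /and4P[a0 b0 e0 f0].
rewrite enc_block_pairs cat_cons -catA cat_cons.
have all_step c : kgstep m c KAll (p, (x, 0)) = (Open false, (x, 0)).
  by case: p final_p => //; rewrite /kgstep /= affine_idE.
have ex_step c v : kgstep m c KEx (After_all, v) = (Open true, v).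
  by rewrite /kgstep /= affine_idE.
rewrite (kgrun_cons _ _ all_step) kgrun_pair //.
split=> [[c]|[c run_c]].
  rewrite (kgrun_cons _ _ (ex_step^~ _)) kgrun_pair // => -[c' run_c'].
  by exists (if m then c' else c); case: m run_c' {all_step ex_step}.
exists c; rewrite (kgrun_cons _ _ (ex_step^~ _)) kgrun_pair //.
by exists c; case: m run_c {all_step ex_step}.
Qed.

Definition total_selected (m : bool) (cs : seq bool) (blks : seq block) : nat :=
  \sum_(cb <- zip cs blks) selected m cb.1 cb.2.

Lemma kgrun_blocks m blks p x y : pfinal p -> all wf_block blks ->
  kgrun m (flatten (map enc_block blks)) (p, (x, 0)) y <->
  exists cs, size cs = size blks /\
    y = (if blks is [::] then p else After_ex, (x - (total_selected m cs blks)%:R, 0)).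
Proof.
elim: blks p x y => [|blk blks IH] p x y final_p /=.
  move=> _; split=> [<-|[cs [/size0nil -> ->]]]; last first.
    by rewrite /total_selected big_nil subr0.
  by exists [::]; rewrite /total_selected big_nil subr0.
have last_state : (if blks is [::] then After_ex else After_ex) = After_ex.
  by case: blks {IH}.
move=> /andP[wf_blk wf_blks]; rewrite kgrun_block //; split=> [[c]|].
  rewrite IH // last_state => -[cs [size_cs ->]]; exists (c :: cs); rewrite /= size_cs.
  by rewrite /total_selected /= big_cons natrD opprD addrA.
case=> -[[]//|c cs [[size_cs] ->]]; exists c; rewrite IH // last_state; exists cs.
by rewrite /total_selected /= big_cons natrD opprD addrA.
Qed.

Lemma kgrun_enc m S blks x y : S != [::] -> all wf_block blks ->
  kgrun m (enc_KG S blks) (Start_sum, (x, 0)) y <->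
  exists cs, size cs = size blks /\
    y = (if blks is [::] then In_sum else After_ex,
         ((if m then x else binary_from x S) - (total_selected m cs blks)%:R, 0)).
Proof. by move=> S0 wf_blks; rewrite kgrun_sum ?kgrun_blocks //; right. Qed.

Fixpoint parses (p : pstate) (o : seq kgsym) : Prop :=
  if o is d :: o' then exists c, parses (pnext c p d) o' else pfinal p.

Lemma kgrun_parses m o x y : kgrun m o x y -> pfinal y.1 -> parses x.1 o.
Proof.
by elim: o x => [|d o IH] x /=; [move=> <-|case=> c /IH{}IH /IH; exists c].
Qed.

Lemma parses_error o : ~ parses Syntax_error o.
Proof. by elim: o => // d o IH [c]; case: d. Qed.

Lemma parses_number ex snd ne ch o : parses (Digits ex snd ne ch) o ->
  exists a o', [/\ ne || (a != [::]),
    o = bits a ++ (if snd then KRp else KComma) :: o' &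
    parses (if snd then after_pair ex else Digits ex true false ch) o'].
Proof.
elim: o ne => [//|d o IH] ne [c].
have digit b : parses (Digits ex snd true ch) o -> exists a o', [/\ ne || (a != [::]),
    (if b then K1 else K0) :: o = bits a ++ (if snd then KRp else KComma) :: o' &
    parses (if snd then after_pair ex else Digits ex true false ch) o'].
  by move=> /IH[a [o' [_ -> ?]]]; exists (b :: a), o'; rewrite orbT.
case: d; case: snd digit {IH}; case: ne => digit /=;
  first [exact: (digit false) | exact: (digit true) | by move=> /parses_error |
         by exists [::], o].
Qed.

Lemma parses_pair ex o : parses (Open ex) o ->
  exists a b o',
    [/\ a != [::], b != [::], o = enc_pair a b ++ o' & parses (after_pair ex) o'].
Proof.
case: o => [//|d o [c]]; case: d => /=; try by move=> /parses_error.
move=> /parses_number[a [_ [a0 -> /parses_number[b [o' [b0 -> ?]]]]]].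
by exists a, b, o'; rewrite /enc_pair /= -!(catA, cat_cons).
Qed.

Lemma parses_blocks o : parses After_ex o ->
  exists2 blks, all wf_block blks & o = flatten (map enc_block blks).
Proof.
have [n] := ubnP (size o); elim: n o => // n IH [|d o]; first by exists [::].
rewrite /= ltnS => size_o [c]; case: d => /=; try by move=> /parses_error.
move=> /parses_pair[a [b [[|d o1] [a0 b0 Eo // [c']]]]].
case: d Eo => Eo /=; try by move=> /parses_error.
move=> /parses_pair[e [f [o2 [e0 f0 Eo1 /IH[|blks wf_blks Eo2]]]]].
  by move: size_o; rewrite Eo Eo1 !size_cat /= !size_cat; lia.
exists ((a, b, e, f) :: blks); first by rewrite /= a0 b0 e0 f0.
rewrite Eo Eo1 Eo2 -[RHS]/(enc_block (a, b, e, f) ++ _) enc_block_pairs.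
by rewrite -!(catA, cat_cons).
Qed.

Lemma parses_sum o : parses In_sum o ->
  exists S blks, all wf_block blks /\ o = bits S ++ flatten (map enc_block blks).
Proof.
elim: o => [|d o IH]; first by exists [::], [::].
have digit b : parses In_sum o -> exists S blks, all wf_block blks /\
    (if b then K1 else K0) :: o = bits S ++ flatten (map enc_block blks).
  by move=> /IH[S [blks [wf_blks ->]]]; exists (b :: S), blks.
case: d => -[c] /=;
  try first [exact: (digit false) | exact: (digit true) | by move=> /parses_error].
move=> parse_o; have [|blks wf_blks ->] := @parses_blocks (KAll :: o); first by exists c.
by exists [::], blks.
Qed.

Lemma parses_enc o : parses Start_sum o ->
  exists S blks, [/\ S != [::], all wf_block blks & o = enc_KG S blks].
Proof.
have digit b o' : parses In_sum o' -> exists S blks,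
    [/\ S != [::], all wf_block blks & (if b then K1 else K0) :: o' = enc_KG S blks].
  by move=> /parses_sum[S [blks [wf_blks ->]]]; exists (b :: S), blks.
case: o => [//|d o [c]]; case: d => /=;
  first [exact: (digit false) | exact: (digit true) | by move=> /parses_error].
Qed.

Definition block_values (blk : block) : nat * nat * nat * nat :=
  let: (a, b, e, f) := blk in (bitval a, bitval b, bitval e, bitval f).

Lemma sum_game_choices cs ds blks : size cs = size blks -> size ds = size blks ->
  (\sum_(i < size (map block_values blks))
     let: (a, b, e, f) := nth (0, 0, 0, 0) (map block_values blks) i in
     ((if nth false cs i then b else a) + (if nth false ds i then f else e)))%N =
  (total_selected false cs blks + total_selected true ds blks)%N.
Proof.
rewrite /total_selected.
elim: blks cs ds => [|[[[a b] e] f] blks IH] [|c cs] [|d ds] //=.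
  by rewrite big_ord0 !big_nil.
case=> size_cs [size_ds]; rewrite big_ord_recl /= IH // !big_cons /=.
by case: c; case: d; rewrite addnACA.
Qed.

Definition kginit : kgstate := (Start_sum, (0, 0)).

Definition second_pass (x : kgstate) : kgstate := (Start_sum, (x.2.1, 0)).

Definition kgwin (x : kgstate) : bool := pfinal x.1 && (x.2.1 == 0).

Definition winning (o : seq kgsym) : Prop := forall x, kgrun false o kginit x ->
  exists2 y, kgrun true o (second_pass x) y & kgwin y.

Definition losing (o : seq kgsym) : Prop := exists2 x, kgrun false o kginit x &
  forall y, kgrun true o (second_pass x) y -> ~~ kgwin y.

Lemma not_winning o : ~ winning o -> losing o.
Proof.
move=> not_win; apply: contrapT => not_lose; apply: not_win => x run_x.
apply: contrapT => no_answer; apply: not_lose; exists x => // y run_y.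
by apply/negP => win_y; apply: no_answer; exists y.
Qed.

Lemma kgrun_second_pass_int o x y : kgrun false o kginit x ->
  kgrun true o (second_pass x) y -> y.2.1 \is a Num.int.
Proof.
move=> run_x run_y; have /andP[int_x _] : int_coords x.2.
  by apply: (kgrun_int run_x); rewrite /int_coords !rpred0.
suff /andP[] : int_coords y.2 by [].
by apply: (kgrun_int run_y); rewrite /int_coords /= int_x rpred0.
Qed.

Lemma KG_game_winning S blks : S != [::] -> all wf_block blks ->
  KG_game (bitval S) (map block_values blks) -> winning (enc_KG S blks).
Proof.
move=> S0 wf_blks game x; rewrite kgrun_enc // => -[cs [size_cs ->]].
have [|ds [size_ds ES]] := game cs; first by rewrite size_map.
rewrite size_map in size_ds; eexists; first by rewrite kgrun_enc //; exists ds.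
rewrite /kgwin /= binary_from0 ES sum_game_choices // -addrA -opprD -natrD subrr.
by case: (blks).
Qed.

Lemma winning_LKG o : winning o -> LKG o.
Proof.
move=> win; have [x run_x] := kgrun_total false o kginit.
have [y run_y /andP[final_y _]] := win x run_x.
have [S [blks [S0 wf_blks Eo]]] := parses_enc (kgrun_parses run_y final_y).
exists S, blks; do 3!split=> //.
move=> cs size_cs'; have size_cs : size cs = size blks by rewrite size_cs' size_map.
pose x' : kgstate := (if blks is [::] then In_sum else After_ex,
  ((bitval S)%:R - (total_selected false cs blks)%:R, 0)).
have [|z] := win x'; rewrite Eo kgrun_enc //; first by exists cs; rewrite binary_from0.
case=> ds [size_ds ->] /andP[_ /=].
rewrite -addrA -opprD -natrD subr_eq0 eqr_nat => /eqP ES.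
by exists ds; split; [rewrite size_map|rewrite ES sum_game_choices].
Qed.

Lemma LKGP o : LKG o <-> winning o.
Proof.
split; last exact: winning_LKG.
by case=> S [blks [S0 [wf_blks [-> game]]]]; apply: KG_game_winning.
Qed.

(** * Positional notation *)

Lemma mixed_radix_inj d q r q' r' : (r < d)%N -> (r' < d)%N ->
  (q * d + r = q' * d + r')%N -> q = q' /\ r = r'.
Proof. by move=> r_lt r'_lt /(congr1 (edivn^~ d)); rewrite /= !edivn_eq // => -[]. Qed.

Lemma mixed_radix_lt d q r m : (r < d)%N -> (q < m)%N -> (q * d + r < m * d)%N.
Proof.
move=> r_lt q_lt; have d_gt0 := leq_ltn_trans (leq0n r) r_lt.
by rewrite -ltn_divLR // divnMDl // divn_small // addn0.
Qed.

(* The first digit is the most significant one. *)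
Definition radix (A : pzSemiRingType) (b : A) (f : nat -> A) (k : nat) : A :=
  \sum_(i < k) b ^+ (k - i.+1) * f i.

Section Radix.
Variables (A : pzSemiRingType) (b : A).
Implicit Types f g : nat -> A.

Lemma radixS f k : radix b f k.+1 = b * radix b f k + f k.
Proof.
rewrite /radix big_ord_recr subnn mul1r mulr_sumr; congr (_ + _).
by apply: eq_bigr => i _; rewrite mulrA -exprS -subSn.
Qed.

Lemma eq_radix f g k : (forall i, (i < k)%N -> f i = g i) -> radix b f k = radix b g k.
Proof. by move=> eq_fg; apply: eq_bigr => i _; rewrite eq_fg. Qed.

Lemma radixD f g k : radix b (fun i => f i + g i) k = radix b f k + radix b g k.
Proof. by rewrite -big_split; apply: eq_bigr => i _; rewrite mulrDr. Qed.

Lemma radixMr f x k : radix b (fun i => f i * x) k = radix b f k * x.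
Proof. by rewrite /radix mulr_suml; apply: eq_bigr => i _; rewrite mulrA. Qed.

Lemma radix_single f p k : (p < k)%N ->
  radix b (fun i => if p == i then f i else 0) k = b ^+ (k - p.+1) * f p.
Proof.
move=> lt_pk; rewrite /radix (bigD1 (Ordinal lt_pk)) //= eqxx big1 ?addr0 // => i.
by rewrite -val_eqE /= eq_sym => /negPf ->; rewrite mulr0.
Qed.

End Radix.

Lemma natr_radix (A : pzSemiRingType) (b : nat) (f : nat -> nat) k :
  (radix b f k)%:R = radix b%:R (fun i => (f i)%:R) k :> A.
Proof.
elim: k => [|k IH]; first by rewrite /radix !big_ord0.
by rewrite !radixS -IH -natrM -natrD.
Qed.

Lemma radix_inj (b : nat) (f g : nat -> nat) k :
  (forall i, (i < k)%N -> (f i < b)%N) -> (forall i, (i < k)%N -> (g i < b)%N) ->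
  radix b f k = radix b g k -> forall i, (i < k)%N -> f i = g i.
Proof.
elim: k => // k IH f_lt g_lt; rewrite !radixS !natrDE !natrME ![(b * _)%N]mulnC.
case/(mixed_radix_inj (f_lt k (ltnSn k)) (g_lt k (ltnSn k))) => eq_k eq_fg i.
rewrite ltnS leq_eqVlt => /orP[/eqP -> //|lt_ik].
by apply: IH lt_ik => // j lt_jk; [apply: f_lt|apply: g_lt]; rewrite ltnW.
Qed.

(** * Configurations as numbers *)

Definition is_left (S : Type) (s : tsym S) : bool := if s is LEnd then true else false.
Definition is_right (S : Type) (s : tsym S) : bool := if s is REnd then true else false.

Lemma is_left_tape (S : Type) (w : seq S) i : is_left (tape_at w i) = (i == 0)%N.
Proof. by case: i => //= i; case: drop. Qed.

Lemma is_right_tape (S : Type) (w : seq S) i : is_right (tape_at w i) = (size w < i)%N.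
Proof. by case: i => //= i; rewrite ltnS -subn_eq0 -size_drop; case: drop. Qed.

Section Machine.
Variables (S : finType) (D : Type) (M : lstm S D) (w : seq S).
Local Notation n := (mc M).
Local Notation N := (size w).+2.
Implicit Types (C : tmconf S D M) (s : tsym S).

Definition scanned C : tsym S * mG M := (tape_at w (cip C), ctape C (cwp C)).

Definition transition C : mQ M * mG M * move * move * option D :=
  mdelta M (cq C) (scanned C).1 (scanned C).2.

Definition emission C : option D := (transition C).2.

Definition in_bounds C : bool :=
  (cip C <= (size w).+1)%N && (cwp C < n * (size w).+1)%N.

Lemma tm_stepE C q a mi mw d : ~~ mhalt M (cq C) -> transition C = (q, a, mi, mw, d) ->
  tm_step S D M w C = TMConf q (move_in (size w).+1 mi (cip C))
    (fun i => if i == cwp C then a else ctape C i) (move_work mw (cwp C))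
    (cout C ++ seq_of_opt d).
Proof. by rewrite /transition /tm_step => /negPf -> ->; case: d. Qed.

Fixpoint halting_run (k : nat) C (o : seq D) : Prop :=
  if k is k'.+1 then
    [/\ ~~ mhalt M (cq C), in_bounds C &
      exists2 o', o = seq_of_opt (emission C) ++ o' & halting_run k' (tm_step S D M w C) o']
  else mhalt M (cq C) /\ o = [::].

Lemma halting_run_iter T C :
  (forall t, in_bounds (iter t (tm_step S D M w) C)) ->
  mhalt M (cq (iter T (tm_step S D M w) C)) ->
  exists k o, halting_run k C o /\ cout (iter T (tm_step S D M w) C) = cout C ++ o.
Proof.
elim: T C => [|T IH] C bounds haltT; first by exists 0%N, [::]; rewrite cats0.
have [haltC|runC] := boolP (mhalt M (cq C)).
  by exists 0%N, [::]; rewrite cats0 iter_fix // /tm_step haltC.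
rewrite iterSr in haltT *.
have [|k [o [run_o ->]]] := IH _ _ haltT; first by move=> t; rewrite -iterSr.
exists k.+1, (seq_of_opt (emission C) ++ o); split.
  by split=> //; [exact: (bounds 0%N)|exists o].
rewrite /emission; case E: (transition C) => [[[[q a] mi] mw] d].
by rewrite (tm_stepE runC E) /= catA.
Qed.

Lemma cip_tm_run t : (cip (tm_run S D M w t) <= (size w).+1)%N.
Proof.
elim: t => [//|t]; rewrite /tm_run iterS; move: (iter _ _ _) => C IH.
rewrite /tm_step; case: ifP => // _; case: mdelta => [[[[q a] []] mw] od] //=.
  exact: leq_trans (leq_pred _) IH.
exact: geq_minr.
Qed.

(* What a configuration shows at a position of the input tape: the [n] work
   cells stored there, the work head if it is on one of them, and whether the
   input head is there. *)
Definition letter := ({ffun 'I_n -> mG M} * option 'I_n * bool)%type.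

Local Notation nb := #|{: {ffun 'I_n -> mG M}}|.

Definition head_code (h : option 'I_n) : nat := if h is Some j then j.+1 else 0%N.

Definition letter_code (l : letter) : nat :=
  ((l.2 * n.+1 + head_code l.1.2) * nb + enum_rank l.1.1)%N.

Definition base : nat := (2 * n.+1 * nb)%N.

Lemma head_code_lt h : (head_code h < n.+1)%N.
Proof. by case: h => //= j; rewrite ltnS. Qed.

Lemma letter_code_lt l : (letter_code l < base)%N.
Proof.
by apply: mixed_radix_lt => //; apply: mixed_radix_lt; [exact: head_code_lt|case: l.2].
Qed.

Lemma letter_code_inj : injective letter_code.
Proof.
move=> [[bl h] i] [[bl' h'] i']; rewrite /letter_code /=.
case/mixed_radix_inj => // /mixed_radix_inj[]; rewrite ?head_code_lt // => eq_i eq_h eq_bl.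
congr (_, _, _); last by case: i i' eq_i => -[].
  exact/enum_rank_inj/val_inj.
by case: h h' eq_h => [j|] [j'|] //= [/val_inj ->].
Qed.

Lemma base_neq0 : base%:R != 0 :> rat.
Proof.
by rewrite pnatr_eq0 -lt0n !muln_gt0 /=; apply/card_gt0P; exists [ffun=> mblank M].
Qed.

Definition work_head (p i : nat) : option 'I_n :=
  if (p %/ n)%N == i then insub (p %% n)%N else None.

Definition letter_of C (i : nat) : letter :=
  ([ffun j : 'I_n => ctape C (n * i + j)], work_head (cwp C) i, cip C == i).

Definition config_code C (k : nat) : nat :=
  radix base (fun i => letter_code (letter_of C i)) k.

Definition init_letter s : letter :=
  ([ffun=> mblank M], if is_left s then insub 0%N else None, is_left s).

Lemma letter_of_init i : letter_of (tm_init S D M) i = init_letter (tape_at w i).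
Proof.
by rewrite /letter_of /init_letter /work_head /= is_left_tape div0n mod0n ![0%N == i]eq_sym.
Qed.

Definition input_mark (mi : move) s : rat :=
  match mi with
  | MLeft => if is_left s then 1 else base%:R
  | MStay => 1
  | MRight => if is_right s then 1 else base%:R^-1
  end.

Definition work_mark (mw : move) s (j : nat) : rat :=
  match mw with
  | MLeft => if (0 < j)%N then j%:R else if is_left s then 1 else base%:R * n%:R
  | MStay => j.+1%:R
  | MRight => if (j.+1 < n)%N then j.+2%:R else base%:R^-1
  end.

Definition write_cell (bl : {ffun 'I_n -> mG M}) (h : option 'I_n) (a : mG M) :
    {ffun 'I_n -> mG M} :=
  if h is Some j then [ffun j' => if j' == j then a else bl j'] else bl.

(* The contribution of the letter [l] to the code of the next configuration; a
   head that leaves for a neighbouring position is accounted for by a factor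
   [base] or [1 / base]. *)
Definition next_digit s (a : mG M) (mi mw : move) (l : letter) : rat :=
  ((if l.2 then input_mark mi s else 0) * n.+1%:R +
   (if l.1.2 is Some j then work_mark mw s j else 0)) * nb%:R +
  (enum_rank (write_cell l.1.1 l.1.2 a))%:R.

Hypothesis n_gt0 : (0 < n)%N.

Local Notation b := (base%:R : rat).

Lemma work_headE p i :
  work_head p i = if (p %/ n)%N == i then Some (Ordinal (ltn_pmod p n_gt0)) else None.
Proof.
rewrite /work_head; case: eqP => // _; case: insubP => [j _ Ej|]; last by rewrite ltn_pmod.
by congr Some; apply: val_inj.
Qed.

Lemma write_cell_work_head C a i :
  write_cell [ffun j : 'I_n => ctape C (n * i + j)] (work_head (cwp C) i) a =
  [ffun j : 'I_n => if (n * i + j == cwp C)%N then a else ctape C (n * i + j)].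
Proof.
rewrite work_headE; apply/ffunP=> j; have E := divn_eq (cwp C) n.
case: eqP => [Ei|ne] /=; rewrite !ffunE.
  congr (if _ then _ else _); apply/eqP/eqP => [->|Ej]; first by rewrite /= -Ei mulnC -E.
  by apply: val_inj => /=; rewrite -Ej mulnC modnMDl modn_small.
by case: eqP => // Ej; case: ne; rewrite -Ej mulnC divnMDl // divn_small // addn0.
Qed.

Lemma radix_input_mark mi p : (p <= (size w).+1)%N ->
  radix b (fun i => if p == i then input_mark mi (tape_at w i) else 0) N =
  radix b (fun i => if move_in (size w).+1 mi p == i then 1 else 0) N.
Proof.
move=> le_p; rewrite !radix_single //; last by case: mi => /=; lia.
rewrite mulr1; case: mi; rewrite /= ?is_left_tape ?is_right_tape ?mulr1 //.
  by case: p le_p => [|p] lt_p; rewrite /= ?mulr1 // -exprSr; congr (_ ^+ _); lia.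
case: ltnP => lt_p; first by rewrite mulr1; congr (_ ^+ _); lia.
have -> : (N - p.+1 = (N - (minn p.+1 (size w).+1).+1).+1)%N by lia.
by rewrite exprSr mulfK ?base_neq0.
Qed.

Lemma radix_work_head (f : nat -> nat -> rat) i j k : (i < k)%N -> (j < n)%N ->
  radix b (fun i' => if work_head (i * n + j) i' is Some j' then f i' j' else 0) k =
  b ^+ (k - i.+1) * f i j.
Proof.
move=> lt_ik lt_jn; rewrite -(radix_single _ (f^~ j) lt_ik); apply: eq_radix => i' _.
have -> : work_head (i * n + j) i' = if i == i' then Some (Ordinal lt_jn) else None.
  rewrite work_headE divnMDl // divn_small // addn0; case: eqP => // _.
  by congr Some; apply: val_inj; rewrite /= modnMDl modn_small.
by case: eqP.
Qed.

Lemma radix_head_code i j k : (i < k)%N -> (j < n)%N ->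
  radix b (fun i' => (head_code (work_head (i * n + j) i'))%:R) k =
  b ^+ (k - i.+1) * j.+1%:R.
Proof.
move=> lt_ik lt_jn; rewrite -(radix_work_head (fun _ j' => j'.+1%:R) lt_ik lt_jn).
by apply: eq_radix => i' _; case: work_head.
Qed.

Lemma radix_work_mark mw p : (p < n * (size w).+1)%N ->
  radix b (fun i => if work_head p i is Some j then work_mark mw (tape_at w i) j else 0) N =
  radix b (fun i => (head_code (work_head (move_work mw p) i))%:R) N.
Proof.
move=> lt_p; have lt_i : (p %/ n < (size w).+1)%N by rewrite ltn_divLR // mulnC.
have := ltn_pmod p n_gt0; rewrite {2 3}(divn_eq p n).
move: (p %/ n)%N (p %% n)%N lt_i => i j lt_i lt_j {p lt_p}.
have lt_iN : (i < N)%N by exact: ltnW.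
rewrite (radix_work_head (fun i => work_mark mw (tape_at w i))) //.
case: mw; rewrite /= ?is_left_tape.
- case: j lt_j => [|j] lt_j /=; last first.
    by rewrite addnS /= radix_head_code // ltnW.
  case: i lt_i lt_iN => [|i] lt_i lt_iN /=; first by rewrite (@radix_head_code 0).
  have -> : ((i.+1 * n + 0).-1 = i * n + n.-1)%N by lia.
  rewrite radix_head_code ?prednK //; last by lia.
  by rewrite mulrA -exprSr; congr (_ ^+ _ * _); lia.
- by rewrite radix_head_code.
case: ltnP => lt_jn; first by rewrite -addnS radix_head_code.
have -> : ((i * n + j).+1 = i.+1 * n + 0)%N by lia.
rewrite radix_head_code // mulr1.
have -> : (N - i.+1 = (N - i.+2).+1)%N by lia.
by rewrite exprSr mulfK ?base_neq0.
Qed.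

Lemma radix_next_digit C a mi mw q out : in_bounds C ->
  radix b (fun i => next_digit (tape_at w i) a mi mw (letter_of C i)) N =
  (config_code (TMConf q (move_in (size w).+1 mi (cip C))
     (fun i => if i == cwp C then a else ctape C i) (move_work mw (cwp C)) out) N)%:R.
Proof.
move=> /andP[le_ip lt_wp]; rewrite natr_radix.
rewrite /next_digit /letter_of /letter_code /= !radixD !radixMr !radixD !radixMr.
rewrite radix_input_mark // radix_work_mark // -!radixMr -!radixD -!radixMr -!radixD.
apply: eq_radix => i _; rewrite write_cell_work_head natrD natrM natrD natrM.
by case: (_ == i).
Qed.

Lemma radix_transition C : in_bounds C -> ~~ mhalt M (cq C) ->
  let: (_, a, mi, mw, _) := transition C in
  radix b (fun i => next_digit (tape_at w i) a mi mw (letter_of C i)) N =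
  (config_code (tm_step S D M w C) N)%:R.
Proof.
case E: (transition C) => [[[[q a] mi] mw] d] bounds run_C.
by rewrite (tm_stepE run_C E); apply: radix_next_digit.
Qed.

End Machine.

Lemma computes_halting_run (S : finType) (D : Type) (M : lstm S D) f w :
  computes_linspace S D M f -> exists k, halting_run w k (tm_init S D M) (f w).
Proof.
move=> comp; have [[T [haltT <-]] space] := comp w.
have [t|k [o [run_o ->]]] := halting_run_iter _ haltT; last by exists k.
by rewrite /in_bounds -[iter _ _ _]/(tm_run S D M w t) cip_tm_run space.
Qed.

(** * The verifier *)

Definition tsym_code (S : Type) (s : tsym S) : option (option S) :=
  match s with LEnd => None | REnd => Some None | Sym a => Some (Some a) end.

Definition tsym_decode (S : Type) (s : option (option S)) : tsym S :=
  match s with None => LEnd | Some None => REnd | Some (Some a) => Sym a end.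

Lemma tsym_codeK (S : Type) : cancel (@tsym_code S) (@tsym_decode S).
Proof. by case. Qed.

HB.instance Definition _ (S : finType) := Finite.copy (tsym S) (can_type (@tsym_codeK S)).

Inductive phase :=
  | Start | Init | Rewind | Step | Flip | Sweep | Scale | Compare | Update
  | Next_pass | Scale_tally | Compare_tally | Lottery | Accept | Reject.

Definition phases : seq phase :=
  [:: Start; Init; Rewind; Step; Flip; Sweep; Scale; Compare; Update;
      Next_pass; Scale_tally; Compare_tally; Lottery; Accept; Reject].

Definition phase_code (ph : phase) : 'I_15 :=
  inord match ph with
  | Start => 0 | Init => 1 | Rewind => 2 | Step => 3 | Flip => 4 | Sweep => 5 | Scale => 6
  | Compare => 7 | Update => 8 | Next_pass => 9 | Scale_tally => 10 | Compare_tally => 11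
  | Lottery => 12 | Accept => 13 | Reject => 14 end%N.

Lemma phase_codeK : cancel phase_code (fun i => nth Reject phases i).
Proof. by case; rewrite /= inordK. Qed.

HB.instance Definition _ := Finite.copy phase (can_type phase_codeK).

(* One of the two [Config] registers holds the value predicted for the current
   configuration and that of the letters received, the other one the prediction
   under construction; they exchange their roles after each step.  [Tally]
   serves the arithmetic of the game, [Stake] the lottery that decides on
   acceptance, and [Coin] the fair coins. *)
Inductive register := Config of bool | Tally | Stake | Coin.

Definition register_code (k : register) : bool + 'I_3 :=
  match k with
  | Config b => inl b
  | Tally => inr (@Ordinal 3 0 isT)
  | Stake => inr (@Ordinal 3 1 isT)
  | Coin => inr (@Ordinal 3 2 isT)
  end.

Definition register_decode (x : bool + 'I_3) : register :=
  match x with inl b => Config b | inr i => nth Coin [:: Tally; Stake] i end.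

Lemma register_codeK : cancel register_code register_decode.
Proof. by case. Qed.

HB.instance Definition _ := Finite.copy register (can_type register_codeK).

Definition bank (T : Type) (p : bool) (cur nxt tally stake coin : T) (k : register) : T :=
  match k with
  | Config p' => if p' == p then cur else nxt
  | Tally => tally
  | Stake => stake
  | Coin => coin
  end.

Lemma bank_swap (T : Type) p (cur nxt tally stake coin : T) :
  bank p cur nxt tally stake coin = bank (~~ p) nxt cur tally stake coin.
Proof. by apply: funext => -[[] | | |] //=; case: p. Qed.

Lemma bank_id p (z : register -> plane) :
  (fun k => bank p affine_id affine_id affine_id affine_id affine_id k (z k)) = z.
Proof. by apply: funext => -[p'| | |] /=; [case: eqP|..]; rewrite affine_idE. Qed.

Section Bank.
Variables (S Q : finType) (w : seq S) (q q' : Q) (i : nat) (p : bool).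
Variables (cur nxt tally stake coin : plane).

Local Notation c := (Conf q i (bank p cur nxt tally stake coin)).

Lemma apply_op_bank f1 f2 f3 f4 f5 mv :
  apply_op w c (bank p f1 f2 f3 f4 f5) q' mv =
  Conf q' (move_in (size w).+1 mv i)
    (bank p (f1 cur) (f2 nxt) (f3 tally) (f4 stake) (f5 coin)).
Proof. by congr Conf; apply: funext => -[p'| | |] //=; case: eqP. Qed.

Lemma observe_config j :
  observe c (Config p) q' j = Conf q' i (bank p (basis_point j) nxt tally stake coin).
Proof.
by congr Conf; apply: funext => -[p'| | |] //; rewrite /upd /=; case: p; case: p'.
Qed.

Lemma observe_tally j :
  observe c Tally q' j = Conf q' i (bank p cur nxt (basis_point j) stake coin).
Proof. by congr Conf; apply: funext => -[p'| | |]. Qed.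

Lemma observe_coin j :
  observe c Coin q' j = Conf q' i (bank p cur nxt tally stake (basis_point j)).
Proof. by congr Conf; apply: funext => -[p'| | |]. Qed.

End Bank.

Section Protocol.
Variables (S : finType) (M : lstm S kgsym) (eps : rat).

(* [pass] holds in the existential pass, [live] is the [Config] register to be
   compared, [announced] are the symbols that the prover claims to be under the
   two heads of the simulated machine. *)
Record memory := Memory {
  pass : bool; live : bool; tm_state : mQ M; parser : pstate;
  announced : tsym S * mG M; chosen : bool }.

Local Notation memory_tuple :=
  (bool * bool * mQ M * pstate * (tsym S * mG M) * bool)%type.

Definition memory_code (x : memory) : memory_tuple :=
  (pass x, live x, tm_state x, parser x, announced x, chosen x).

Definition memory_decode (x : memory_tuple) : memory :=
  let: (m, p, q, y, ua, c) := x in Memory m p q y ua c.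

Lemma memory_codeK : cancel memory_code memory_decode.
Proof. by case. Qed.

HB.instance Definition _ := Finite.copy memory (can_type memory_codeK).

Record message := Message {
  msg_symbols : tsym S * mG M; msg_choice : bool; msg_letter : letter M }.

Local Notation message_tuple := ((tsym S * mG M) * bool * letter M)%type.

Definition message_code (g : message) : message_tuple :=
  (msg_symbols g, msg_choice g, msg_letter g).

Definition message_decode (x : message_tuple) : message :=
  let: (ua, c, l) := x in Message ua c l.

Lemma message_codeK : cancel message_code message_decode.
Proof. by case. Qed.

HB.instance Definition _ := Finite.copy message (can_type message_codeK).

Definition control : finType := (phase * memory)%type.

Local Notation b := ((base M)%:R : rat).

Definition agrees (s : tsym S) (ua : tsym S * mG M) (l : letter M) : bool :=
  (l.2 ==> (s == ua.1)) && (if l.1.2 is Some j then l.1.1 j == ua.2 else true).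

Definition idle (p : bool) : register -> affine_map :=
  bank p affine_id affine_id affine_id affine_id affine_id.

Definition game_prog (x : control) (s : tsym S) (g : message) : instr control register :=
  let: (ph, mem) := x in
  let: Memory m p q y ua c := mem in
  let i := affine_id in
  let zero := affine_const (0, 0) in
  match ph with
  | Start =>
      Op (bank false zero zero zero (affine_const (2 / eps, - (2 / eps))) zero)
        (Init, Memory false false (mq0 M) Start_sum ua c) MStay
  | Init =>
      Op (bank p (affine_fst b (letter_code (init_letter M s))%:R) i i i i)
        (if is_right s then Rewind else Init, mem) MRight
  | Rewind => Op (idle p) (if is_left s then Step else Rewind, mem) MLeft
  | Step =>
      if mhalt M q then Op (idle p) (if m then Scale_tally else Next_pass, mem) MStay
      else Op (bank p i i i (affine_scale 2) (affine_const (1 / 2, 0)))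
             (Flip, Memory m p q y (msg_symbols g) (msg_choice g)) MStay
  | Flip =>
      Weigh Coin (Sweep, Memory m p q y ua (if m then c else true))
        (Sweep, Memory m p q y ua (if m then c else false))
  | Sweep =>
      if agrees s ua (msg_letter g) then
        let: (_, a, mi, mw, _) := mdelta M q ua.1 ua.2 in
        Op (bank p (affine_snd b (letter_code (msg_letter g))%:R)
              (affine_fst b (next_digit s a mi mw (msg_letter g))) i i i)
          (if is_right s then Scale else Sweep, mem) MRight
      else Op (idle p) (Reject, mem) MStay
  | Scale =>
      Op (bank p (affine_opposites (1 / eps) (- (1 / eps))) i i i i) (Compare, mem) MStay
  | Compare => Weigh (Config p) (Update, mem) (Reject, mem)
  | Update =>
      let: (q', _, _, _, d) := mdelta M q ua.1 ua.2 in
      Op (bank p zero i (if d is Some e then parith m y e else i) i i)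
        (Rewind, Memory m (~~ p) q' (if d is Some e then pnext c y e else y) ua c) MStay
  | Next_pass =>
      Op (bank false zero zero (affine_snd 0 0) i i)
        (Init, Memory true false (mq0 M) Start_sum ua c) MStay
  | Scale_tally =>
      if pfinal y then
        Op (bank p i i (affine_opposites (1 / eps) 0) i i) (Compare_tally, mem) MStay
      else Op (idle p) (Reject, mem) MStay
  | Compare_tally => Weigh Tally (Lottery, mem) (Reject, mem)
  | Lottery => Weigh Stake (Accept, mem) (Start, mem)
  | Accept | Reject => Op (idle p) x MStay
  end.

Definition accepting (x : control) : bool := if x.1 is Accept then true else false.
Definition rejecting (x : control) : bool := if x.1 is Reject then true else false.

Lemma accepting_rejecting x : ~~ (accepting x && rejecting x).
Proof. by case: x => -[]. Qed.

Definition initial_control : control :=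
  (Start, Memory false false (mq0 M) Start_sum (LEnd, mblank M) false).

Definition default_message : message := Message (LEnd, mblank M) false (init_letter M LEnd).

Hypothesis n_gt0 : (0 < mc M)%N.
Hypothesis eps_gt0 : 0 < eps.
Variable w : seq S.

Local Notation N := (size w).+2.
Local Notation tm_start := (tm_init S kgsym M).
Local Notation tm_next := (tm_step S kgsym M w).
Local Notation conf := (conf control register).
Local Notation running := (running accepting rejecting).
Local Notation instr_at := (instr_at game_prog w).
Local Notation rejects_ge := (rejects_ge initial_control accepting rejecting game_prog w).
Local Notation closed := (closed accepting rejecting game_prog w).
Implicit Types (W : conf -> Prop) (C : tmconf S kgsym M) (x y : kgstate).

Definition at_step W (m p : bool) C x (A : rat) : Prop :=
  forall ua c coin, W (Conf (Step, Memory m p (cq C) x.1 ua c) 0%N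
    (bank p ((config_code C N)%:R, 0) (0, 0) x.2 (A, - A) coin)).

Definition after_step W (m p : bool) C x (c : bool) (A : rat) : Prop :=
  at_step W m (~~ p) (tm_next C) (kgstep_opt m c (emission w C) x) A.

Definition at_halt W (m : bool) x (A : rat) : Prop :=
  forall p C, mhalt M (cq C) -> at_step W m p C x A.

Section Closed.
Variable W : conf -> Prop.
Hypothesis closed_W : closed W.

Lemma closed_rewind mem i z : W (Conf (Step, mem) 0%N z) -> W (Conf (Rewind, mem) i z).
Proof.
case: mem => m p q s ua c W_step; elim: i => [|i IH];
  by apply: (closed_op closed_W) => //; rewrite /apply_op bank_id is_left_tape.
Qed.

Lemma closed_init m p q s ua c nxt tally stake coin (mem := Memory m p q s ua c) :
  W (Conf (Step, mem) 0%N (bank p ((config_code tm_start N)%:R, 0) nxt tally stake coin)) ->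
  W (Conf (Init, mem) 0%N (bank p (0, 0) nxt tally stake coin)).
Proof.
move=> W_step; pose P i := W (Conf (if (i < N)%N then Init else Rewind, mem)
  (minn i (size w).+1) (bank p ((config_code tm_start i)%:R, 0) nxt tally stake coin)).
suff : P 0%N by rewrite /P min0n /config_code /radix big_ord0.
apply: (@descending_ind P N) => [|i lt_iN W_next].
  by rewrite /P ltnn; apply: closed_rewind.
rewrite /P lt_iN (minn_idPl _) //; apply: (closed_op closed_W) => //.
rewrite apply_op_bank !affine_idE affine_fstE is_right_tape.
move: W_next; rewrite /P /config_code radixS natrDE natrME natrD natrM.
by rewrite (letter_of_init M w) (_ : (i.+1 < N)%N = ~~ (size w < i)%N) ?if_neg //; lia.
Qed.

Lemma closed_start mem z : at_step W false false tm_start kginit (2 / eps) ->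
  W (Conf (Start, mem) 0%N z).
Proof.
case: mem => m p q s ua c W_step; apply: (closed_op closed_W) => //.
rewrite (_ : apply_op _ _ _ _ _ = Conf (Init, Memory false false (mq0 M) Start_sum ua c) 0%N
   (bank false (0, 0) (0, 0) (0, 0) (2 / eps, - (2 / eps)) (0, 0))).
  exact/closed_init/W_step.
by congr Conf; apply: funext => -[[] | | |]; apply: affine_constE.
Qed.

Lemma closed_next_pass x A :
  at_step W true false tm_start (second_pass x) A -> at_halt W false x A.
Proof.
case: x => s [t1 t2] W_step p C halt_C ua c coin; apply: (closed_op closed_W) => //.
  by move=> g; rewrite /instr_at /= halt_C.
rewrite /apply_op bank_id; apply: (closed_op closed_W) => //.
have [cur [nxt ->]] : exists cur nxt,
    bank p ((config_code C N)%:R, 0) (0, 0) (t1, t2) (A, - A) coin =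
    bank false cur nxt (t1, t2) (A, - A) coin.
  by case: p; [rewrite bank_swap|]; do 2!eexists.
rewrite apply_op_bank !affine_constE affine_sndE mul0r addr0 !affine_idE.
exact/closed_init/W_step.
Qed.

Lemma closed_compare m p C x c A i v coin : ~~ mhalt M (cq C) ->
  after_step W m p C x c A ->
  W (Conf (Scale, Memory m p (cq C) x.1 (scanned w C) c) i
       (bank p (v, v) ((config_code (tm_next C) N)%:R, 0) x.2 (A, - A) coin)).
Proof.
move=> run_C W_next; apply: (closed_op closed_W) => //.
rewrite apply_op_bank affine_oppositesE !affine_idE mulNr subrr oppr0.
apply: (closed_sure closed_W) => //.
  by rewrite /= eqxx -{2}oppr0 last_prob_opposites normr0 mulr0 addr0 invr1.
rewrite observe_config; move: W_next.
rewrite /after_step /emission; case E: (transition w C) => [[[[q a] mi] mw] d] W_next.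
apply: (closed_op closed_W) => //.
  by move=> g; rewrite /instr_at /= [mdelta _ _ _ _]E.
rewrite apply_op_bank affine_constE !affine_idE bank_swap.
have -> : q = cq (tm_next C) by rewrite (tm_stepE run_C E).
apply: closed_rewind; have := W_next (scanned w C) c coin.
by case: d {E W_next} => [d|] //=; rewrite affine_idE.
Qed.

Lemma closed_scale_tally x A : pfinal x.1 ->
  (forall p C ua c coin, W (Conf (Compare_tally, Memory true p (cq C) x.1 ua c) 0%N
     (bank p ((config_code C N)%:R, 0) (0, 0) (x.2.1 / eps, - (x.2.1 / eps))
        (A, - A) coin))) ->
  at_halt W true x A.
Proof.
case: x => s [t1 t2] /= final_s W_compare p C halt_C ua c coin.
apply: (closed_op closed_W) => //; first by move=> g; rewrite /instr_at /= halt_C.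
rewrite /apply_op bank_id; apply: (closed_op closed_W) => //.
  by move=> g; rewrite /instr_at /= final_s.
by rewrite apply_op_bank affine_oppositesE mul0r addr0 mul1r mulrC !affine_idE.
Qed.

End Closed.

Definition consistent (ua : tsym S * mG M) (ls : nat -> letter M) (i : nat) : Prop :=
  forall j, (j < i)%N -> agrees (tape_at w j) ua (ls j).

Definition predicted_digit (q : mQ M) (ua : tsym S * mG M) (ls : nat -> letter M)
    (i : nat) : rat :=
  let: (_, a, mi, mw, _) := mdelta M q ua.1 ua.2 in
  next_digit (tape_at w i) a mi mw (ls i).

Definition received (ls : nat -> letter M) (i : nat) : nat :=
  radix (base M) (fun j => letter_code (ls j)) i.

Section Sweep.
Variables (m p : bool) (q : mQ M) (s : pstate) (ua : tsym S * mG M) (c : bool).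
Variables (h : rat) (tally stake coin : plane).

Local Notation mem := (Memory m p q s ua c).

(* The sweep after the letters [ls 0], ..., [ls i.-1] have been received. *)
Definition sweep_conf (ls : nat -> letter M) (i : nat) : conf :=
  Conf (if (i < N)%N then Sweep else Scale, mem) (minn i (size w).+1)
    (bank p (h, (received ls i)%:R) (radix b (predicted_digit q ua ls) i, 0)
       tally stake coin).

Lemma sweep_conf0 ls :
  sweep_conf ls 0 = Conf (Sweep, mem) 0%N (bank p (h, 0) (0, 0) tally stake coin).
Proof. by rewrite /sweep_conf /received /radix !big_ord0. Qed.

Lemma sweep_confN ls : sweep_conf ls N =
  Conf (Scale, mem) (size w).+1
    (bank p (h, (received ls N)%:R) (radix b (predicted_digit q ua ls) N, 0)
       tally stake coin).
Proof. by rewrite /sweep_conf ltnn (minn_idPr _). Qed.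

Lemma eq_sweep_conf ls ls' i : (forall j, (j < i)%N -> ls j = ls' j) ->
  sweep_conf ls i = sweep_conf ls' i.
Proof.
move=> eq_ls; rewrite /sweep_conf /received.
congr (Conf _ _ (bank _ (_, _%:R) (_, _) _ _ _)); apply: eq_radix => j /eq_ls E.
  by rewrite E.
by rewrite /predicted_digit E.
Qed.

Lemma running_sweep_conf ls i : running (sweep_conf ls i).
Proof. by rewrite /running /sweep_conf /=; case: ifP. Qed.

Lemma sweep_instr ls i g : (i < N)%N -> msg_letter g = ls i ->
  if agrees (tape_at w i) ua (ls i)
  then exists f q' mv, instr_at (sweep_conf ls i) g = Op f q' mv /\
         apply_op w (sweep_conf ls i) f q' mv = sweep_conf ls i.+1
  else instr_at (sweep_conf ls i) g = Op (idle p) (Reject, mem) MStay.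
Proof.
move=> lt_iN Eg; rewrite /instr_at /sweep_conf lt_iN (minn_idPl _) //= Eg.
case: agrees => //; rewrite /received !radixS /predicted_digit.
case: mdelta => [[[[q' a] mi] mw] d]; do 3!eexists; split; first by [].
rewrite apply_op_bank affine_sndE affine_fstE !affine_idE is_right_tape.
rewrite natrDE natrME natrD natrM; congr (Conf (_, _) _ _).
by rewrite (_ : (i.+1 < N)%N = ~~ (size w < i)%N) ?if_neg //; lia.
Qed.

Lemma rejects_sweep v : v <= 1 ->
  (forall ls, consistent ua ls N -> rejects_ge (sweep_conf ls N) v) ->
  rejects_ge (Conf (Sweep, mem) 0%N (bank p (h, 0) (0, 0) tally stake coin)) v.
Proof.
move=> v_le1 rej_end.
pose P i := forall ls, consistent ua ls i -> rejects_ge (sweep_conf ls i) v.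
suff rej0 : P 0%N by rewrite -(sweep_conf0 (fun=> init_letter M LEnd)); apply: rej0.
apply: (@descending_ind P N rej_end) => i lt_iN rej_next ls agr.
apply: rejects_ge_step (running_sweep_conf _ _) _ => g.
pose ls' j := if j == i then msg_letter g else ls j.
have ls'_below j : (j < i)%N -> ls' j = ls j by rewrite /ls' => /ltn_eqF ->.
have ls'_i : msg_letter g = ls' i by rewrite /ls' eqxx.
rewrite -(eq_sweep_conf ls'_below).
have := sweep_instr lt_iN ls'_i; case: ifP => [agr_i [f [q' [mv [-> ->]]]]|_ ->].
  apply: rej_next => j; rewrite ltnS leq_eqVlt => /orP[/eqP -> //|lt_ji].
  by rewrite ls'_below // agr.
exact: rejects_ge_rej.
Qed.

Lemma safe_sweep goal ls (safe := safe accepting rejecting game_prog w goal) :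
  consistent ua ls N -> safe (sweep_conf ls N) ->
  safe (Conf (Sweep, mem) 0%N (bank p (h, 0) (0, 0) tally stake coin)).
Proof.
move=> agr safe_end; rewrite -(sweep_conf0 ls).
pose P i := safe (sweep_conf ls i).
apply: (@descending_ind P N safe_end) => i lt_iN safe_next.
pose g := Message (msg_symbols default_message) false (ls i).
apply: (safe_cons (g := g)) (running_sweep_conf _ _) _; rewrite /safe_message.
have := @sweep_instr ls i g lt_iN erefl.
by rewrite agr // => -[f [q' [mv [-> ->]]]].
Qed.

End Sweep.

Lemma consistent_letter_of C : consistent (scanned w C) (letter_of C) N.
Proof.
move=> i _; apply/andP; split=> /=; first by apply/implyP=> /eqP ->.
by rewrite work_headE //; case: eqP => // <-; rewrite ffunE /= mulnC -divn_eq.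
Qed.

Lemma consistent_scanned C ua : in_bounds w C -> consistent ua (letter_of C) N ->
  ua = scanned w C.
Proof.
case: ua => u a /andP[le_ip lt_wp] agr; have lt_wi : (cwp C %/ mc M < N)%N.
  by rewrite ltn_divLR // (leq_trans lt_wp) // mulnC leq_mul2r leqnSn orbT.
have /andP[/= + _] := agr _ (le_ip : (cip C < N)%N); rewrite eqxx /scanned => /eqP <-.
have /andP[_] := agr _ lt_wi; rewrite /= work_headE // eqxx ffunE /= mulnC -divn_eq.
by move=> /eqP ->.
Qed.

Lemma radix_predicted_digit C : in_bounds w C -> ~~ mhalt M (cq C) ->
  radix b (predicted_digit (cq C) (scanned w C) (letter_of C)) N =
  (config_code (tm_next C) N)%:R.
Proof.
move=> bounds_C run_C; have := radix_transition n_gt0 bounds_C run_C.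
rewrite /predicted_digit -[mdelta _ _ _ _]/(transition w C).
by case: transition => [[[[]]]].
Qed.

Lemma received_config_code C ls : received ls N = config_code C N ->
  forall i, (i < N)%N -> ls i = letter_of C i.
Proof.
move=> eq_code i lt_iN; apply: letter_code_inj.
by apply: (radix_inj _ _ eq_code) lt_iN => j _; apply: letter_code_lt.
Qed.

Lemma last_prob_nonzero_int d : d \is a Num.int -> d != 0 ->
  last_prob (d / eps, - (d / eps)) <= eps / 2.
Proof.
move=> d_int d_neq0; rewrite last_prob_opposites normrM normfV (gtr0_norm eps_gt0).
have le_norm : 1 / eps <= `|d| / eps by rewrite ler_pM2r ?invr_gt0 // norm_intr_ge1.
have inv_gt0 : 0 < 1 / eps by rewrite divr_gt0.
by rewrite -[leRHS]invrK lef_pV2 ?posrE ?invr_gt0 ?divr_gt0 // ?invf_div; lra.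
Qed.

Lemma rejects_mismatch m p q s ua c i (h k : nat) nxt tally stake coin : h != k ->
  rejects_ge (Conf (Scale, Memory m p q s ua c) i
    (bank p (h%:R, k%:R) nxt tally stake coin)) (1 - eps / 2).
Proof.
move=> neq_hk; apply: (closed_op (closed_rejects_ge _)) => //.
rewrite apply_op_bank affine_oppositesE.
have -> : 1 / eps * h%:R + - (1 / eps) * k%:R = (h%:R - k%:R) / eps by ring.
apply: rejects_ge_test => //=; rewrite eqxx subKr.
by rewrite last_prob_nonzero_int ?rpredB ?rpred_nat // subr_eq0 eqr_nat.
Qed.

Lemma rejects_config_sweep m p C x ua c A coin v : in_bounds w C -> ~~ mhalt M (cq C) ->
  v <= 1 - eps / 2 -> after_step (rejects_ge^~ v) m p C x c A ->
  rejects_ge (Conf (Sweep, Memory m p (cq C) x.1 ua c) 0%N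
    (bank p ((config_code C N)%:R, 0) (0, 0) x.2 (A, - A) coin)) v.
Proof.
move=> bounds_C run_C le_v rej_next.
apply: rejects_sweep => [|ls agr]; first by move: eps_gt0; lra.
rewrite sweep_confN; have [eq_code|neq_code] := eqVneq (received ls N) (config_code C N).
  have eq_ls := received_config_code eq_code.
  have Eua : ua = scanned w C.
    by apply: consistent_scanned => // i lt_iN; rewrite -eq_ls // agr.
  rewrite eq_code (@eq_radix _ b _ (predicted_digit (cq C) ua (letter_of C))).
    by rewrite Eua radix_predicted_digit //; apply: (closed_compare (closed_rejects_ge _)).
  by move=> i lt_iN; rewrite /predicted_digit eq_ls.
by apply: rejects_ge_le le_v _; apply: rejects_mismatch; rewrite eq_sym.
Qed.

Lemma rejects_at_step m p C x A (v : bool -> rat) : in_bounds w C -> ~~ mhalt M (cq C) ->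
  (forall c, v c <= 1 - eps / 2) ->
  (forall c' c, after_step (rejects_ge^~ (v c)) m p C x (if m then c' else c) (2 * A)) ->
  at_step (rejects_ge^~ ((v true + v false) / 2)) m p C x A.
Proof.
move=> bounds_C run_C le_v rej_next ua c coin; apply: rejects_ge_step => // g.
rewrite /instr_at /= (negPf run_C) apply_op_bank.
rewrite affine_scaleE mulrN affine_constE !affine_idE.
apply: rejects_ge_step => // g' /=; exists (v true), (v false); split=> [|j lt_j2|].
- by rewrite observe_coin; apply: rejects_config_sweep.
- by rewrite observe_coin; apply: rejects_config_sweep.
by rewrite /weigh_mean last_prob_half; lra.
Qed.

Definition step_stable W (m : bool) : Prop := forall p C x A,
  in_bounds w C -> ~~ mhalt M (cq C) ->
  (forall c, after_step W m p C x c (2 * A)) -> at_step W m p C x A.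

Lemma rejects_step_stable v m : v <= 1 - eps / 2 -> step_stable (rejects_ge^~ v) m.
Proof.
move=> le_v p C x A bounds_C run_C rej_next.
have -> : v = ((fun=> v) true + (fun=> v) false) / 2 by lra.
by apply: (rejects_at_step (v := fun=> v)) => // c' c; apply: rej_next.
Qed.

Lemma step_stable_pass W m k o p C x A : step_stable W m -> halting_run w k C o ->
  (forall y, kgrun m o x y -> at_halt W m y (2 ^+ k * A)) -> at_step W m p C x A.
Proof.
move=> stable_W; elim: k o p C x A => [|k IH] o p C x A /=.
  by case=> halt_C -> W_halt; rewrite -[A]mul1r; apply: W_halt.
case=> run_C bounds_C [o' -> run_o']; rewrite exprSr -mulrA => W_halt.
apply: stable_W => // c; apply: IH run_o' _ => y run_y; apply: W_halt.
by apply/kgrun_emission; exists c.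
Qed.

(* With probability at least [1 / 2 ^+ k], the coins make the choices that lead
   to [y]. *)
Lemma rejects_universal_pass k o p C x y A v v' :
  v <= v' -> v' <= 1 - eps / 2 -> halting_run w k C o ->
  (forall z, at_halt (rejects_ge^~ v) false z (2 ^+ k * A)) ->
  kgrun false o x y -> at_halt (rejects_ge^~ v') false y (2 ^+ k * A) ->
  at_step (rejects_ge^~ (mix v v' k)) false p C x A.
Proof.
move=> le_v le_v'; elim: k o p C x A => [|k IH] o p C x A /=.
  by case=> halt_C -> _ <-; rewrite mix0 mul1r => rej_y; apply: rej_y.
rewrite exprSr -mulrA.
case=> run_C bounds_C [o' -> run_o'] rej_all /kgrun_emission[c0 run_y] rej_y.
have /andP[le_mix mix_le] := mix_bounds k le_v.
pose u c := if c == c0 then mix v v' k else v.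
have -> : mix v v' k.+1 = (u true + u false) / 2.
  by rewrite mixS /u; case: c0 {run_y u} => //=; rewrite addrC.
apply: rejects_at_step => // [c|_ c]; first by rewrite /u; case: eqP => _; lra.
rewrite /u; case: eqP => [->|_]; first exact: IH run_o' _ run_y _.
by apply: step_stable_pass run_o' _ => //; apply: rejects_step_stable; lra.
Qed.

Definition rejects_restart (v : rat) : Prop :=
  forall mem z, rejects_ge (Conf (Start, mem) 0%N z) v.

Lemma rejects_syntax_error v x A : ~~ pfinal x.1 -> v <= 1 ->
  at_halt (rejects_ge^~ v) true x A.
Proof.
move=> syntax v_le1 p C halt_C ua c coin; apply: (closed_op (closed_rejects_ge _)) => //.
  by move=> g; rewrite /instr_at /= halt_C.
rewrite /apply_op bank_id; apply: (closed_op (closed_rejects_ge _)) => //.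
  by move=> g; rewrite /instr_at /= (negPf syntax).
exact: rejects_ge_rej.
Qed.

Lemma rejects_lottery v x A : rejects_restart v -> 0 <= v -> v <= 1 ->
  at_halt (rejects_ge^~ ((1 - last_prob (A, - A)) * v)) true x A.
Proof.
move=> rej_v v_ge0 v_le1; set u := _ * v.
have u_le1 : u <= 1 by rewrite mulr_ile1 ?subr_ge0 ?last_prob_le1 // gerBl last_prob_ge0.
have [final_x|syntax] := boolP (pfinal x.1); last exact: rejects_syntax_error.
apply: (closed_scale_tally (closed_rejects_ge _)) => // p C ua c coin.
apply: rejects_ge_weigh => // [|j _]; last exact: rejects_ge_rej.
rewrite observe_tally; apply: rejects_ge_step => // g /=.
exists 0, v; split=> [|j _|]; [exact: rejects_ge0|exact: rej_v|].
by rewrite /weigh_mean mulr0 add0r.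
Qed.

Lemma rejects_loss x A : x.2.1 \is a Num.int -> ~~ kgwin x ->
  at_halt (rejects_ge^~ (1 - eps / 2)) true x A.
Proof.
move=> int_x loss; have [final_x|syntax] := boolP (pfinal x.1); last first.
  by apply: rejects_syntax_error => //; move: eps_gt0; lra.
apply: (closed_scale_tally (closed_rejects_ge _)) => // p C ua c coin.
apply: rejects_ge_test => //; rewrite /= subKr.
by apply: last_prob_nonzero_int => //; move: loss; rewrite /kgwin final_x.
Qed.

Section Run.
Variables (k : nat) (o : seq kgsym).
Hypothesis run_o : halting_run w k tm_start o.

(* The stake is doubled at each of the [k] steps of both passes. *)
Definition final_stake : rat := 2 ^+ k * (2 ^+ k * (2 / eps)).

Lemma final_stake_gt0 : 0 < final_stake.
Proof. by rewrite /final_stake !mulr_gt0 ?exprn_gt0 ?invr_gt0. Qed.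

Definition accept_prob : rat := last_prob (final_stake, - final_stake).

Lemma accept_prob_gt0 : 0 < accept_prob.
Proof.
rewrite /accept_prob last_prob_opposites invr_gt0 (gtr0_norm final_stake_gt0).
by have := final_stake_gt0; lra.
Qed.

Lemma accept_prob_le : accept_prob <= eps / 4 / 2 ^+ k.
Proof.
have pow_gt0 : 0 < (2 ^+ k : rat) by rewrite exprn_gt0.
rewrite /accept_prob last_prob_opposites (gtr0_norm final_stake_gt0) -[leRHS]invrK.
rewrite lef_pV2 ?posrE ?invr_gt0 ?divr_gt0 //; last by have := final_stake_gt0; lra.
have -> : (eps / 4 / 2 ^+ k)^-1 = 2 * (2 ^+ k * (2 / eps)).
  by field; rewrite !gt_eqF.
have : 2 ^+ k * (2 / eps) <= final_stake.
  by rewrite ler_peMl ?exprn_ege1 // mulr_ge0 ?divr_ge0 // ltW.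
lra.
Qed.

Section Soundness.
Hypothesis lose : losing o.

Lemma rejects_round v : rejects_restart v -> 0 <= v -> v <= 1 - eps / 2 ->
  rejects_restart (mix ((1 - accept_prob) * v) (1 - eps / 2) k).
Proof.
move=> rej_v v_ge0 v_le mem z; have [x run_x lose_x] := lose.
set u := (1 - accept_prob) * v.
have le_uv : u <= v by rewrite ler_piMl // gerBl last_prob_ge0.
have le_u := le_trans le_uv v_le.
apply: (closed_start (closed_rejects_ge _)).
apply: rejects_universal_pass run_o _ (run_x) _ => // [z'|].
  apply: (closed_next_pass (closed_rejects_ge _)).
  apply: step_stable_pass run_o _; first exact: rejects_step_stable.
  by move=> y _; apply: rejects_lottery => //; move: v_le eps_gt0; lra.
apply: (closed_next_pass (closed_rejects_ge _)).
apply: step_stable_pass run_o _; first exact: rejects_step_stable.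
by move=> y run_y; apply: rejects_loss (kgrun_second_pass_int run_x run_y) (lose_x y run_y).
Qed.

Lemma rejects_restart_gain v : rejects_restart v -> 0 <= v -> v < 1 - eps ->
  rejects_restart (v + eps / 4 / 2 ^+ k).
Proof.
move=> rej_v v_ge0 v_lt mem z.
have v_le : v <= 1 - eps / 2 by move: v_lt eps_gt0; lra.
apply: rejects_ge_le (rejects_round rej_v v_ge0 v_le mem z).
have := accept_prob_le; have := last_prob_ge0 (final_stake, - final_stake).
rewrite -/accept_prob /mix.
have : 0 < (2 ^+ k : rat)^-1 by rewrite invr_gt0 exprn_gt0.
have : (2 ^+ k : rat)^-1 <= 1 by rewrite invf_le1 ?exprn_ege1 ?exprn_gt0.
move: accept_prob (_ ^-1) => P r r_le1 r_gt0 P_ge0 P_le.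
have : P * v <= P by rewrite ler_piMr //; move: v_lt eps_gt0; lra.
have : 0 <= r * (P * v) by rewrite !mulr_ge0 // ltW.
have : r * (eps / 2) <= r * (1 - eps / 2 - v) by rewrite ler_pM2l //; lra.
lra.
Qed.

Lemma rejects_restart_bound : exists2 v, 1 - eps <= v & rejects_restart v.
Proof.
apply: (@archimedean_climb _ rejects_restart (eps / 4 / 2 ^+ k)).
- by rewrite !divr_gt0 ?exprn_gt0.
- by move=> mem z; apply: rejects_ge0.
exact: rejects_restart_gain.
Qed.

End Soundness.

Section Completeness.
Hypothesis win : winning o.

Definition at_lottery (d : conf) : Prop :=
  [/\ (st d).1 = Lottery, hd d = 0%N & rg d Stake = (final_stake, - final_stake)].

Local Notation safe := (safe accepting rejecting game_prog w at_lottery).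

Lemma safe_at_step m p C x A c' : in_bounds w C -> ~~ mhalt M (cq C) ->
  (forall c, after_step safe m p C x (if m then c' else c) (2 * A)) ->
  at_step safe m p C x A.
Proof.
move=> bounds_C run_C safe_next ua c coin.
pose g := Message (scanned w C) c' (init_letter M LEnd).
apply: (safe_cons (g := g)) => //; rewrite /safe_message /instr_at /= (negPf run_C).
rewrite apply_op_bank affine_scaleE mulrN affine_constE !affine_idE.
have safe_sweep_config c1 coin1 : safe (Conf
    (Sweep, Memory m p (cq C) x.1 (scanned w C) (if m then c' else c1)) 0%N
    (bank p ((config_code C N)%:R, 0) (0, 0) x.2 (2 * A, - (2 * A)) coin1)).
  apply: safe_sweep (@consistent_letter_of C) _.
  rewrite sweep_confN radix_predicted_digit //.
  exact: (closed_compare (closed_safe default_message)).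
apply: (safe_cons (g := default_message)) => //.
by split=> [|_ j lt_j2]; rewrite observe_coin.
Qed.

Lemma safe_existential_pass i o' p C x y A : halting_run w i C o' -> kgrun true o' x y ->
  at_halt safe true y (2 ^+ i * A) -> at_step safe true p C x A.
Proof.
elim: i o' p C x A => [|i IH] o' p C x A /=.
  by case=> halt_C -> <-; rewrite mul1r => safe_halt; apply: safe_halt.
rewrite exprSr -mulrA.
case=> run_C bounds_C [o1 -> run_o1] /kgrun_emission[c' run_y] safe_halt.
by apply: (@safe_at_step _ _ _ _ _ c') => // c; apply: IH run_o1 run_y safe_halt.
Qed.

Lemma safe_win x : kgwin x -> at_halt safe true x final_stake.
Proof.
move=> /andP[final_x /eqP x0].
apply: (closed_scale_tally (closed_safe default_message)) => // p C ua c coin.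
rewrite x0 mul0r; apply: (closed_sure (closed_safe default_message)) => //.
  by rewrite /= last_prob_opposites normr0 mulr0 addr0 invr1.
by rewrite observe_tally; apply: safe_goal.
Qed.

Lemma safe_restart mem z : safe (Conf (Start, mem) 0%N z).
Proof.
apply: (closed_start (closed_safe default_message)); apply: step_stable_pass run_o _.
  by move=> p C x A bounds_C run_C safe_next; apply: (@safe_at_step _ _ _ _ _ true).
move=> x /win[y run_y win_y]; apply: (closed_next_pass (closed_safe default_message)).
exact: safe_existential_pass run_o run_y (safe_win win_y).
Qed.

Lemma retriable_lottery : retriable accepting rejecting game_prog w at_lottery accept_prob.
Proof.
case=> -[ph [m p q s ua c]] h z [/= -> -> stake]; split=> //.
exists Stake, (Accept, Memory m p q s ua c), (Start, Memory m p q s ua c).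
by split=> //; [rewrite stake|move=> j _; apply: safe_restart].
Qed.

End Completeness.
End Run.
End Protocol.

Section Verification.
Variables (S : finType) (M : lstm S kgsym) (f : seq S -> seq kgsym) (eps : rat).
Hypotheses (comp : computes_linspace S kgsym M f) (eps_gt0 : 0 < eps).

Definition game_verifier : verifier S :=
  prog_verifier (initial_control M) (@accepting S M) (@rejecting S M) (game_prog eps).

Lemma computes_mc_gt0 : (0 < mc M)%N.
Proof. by have [_ /(_ 0%N)] := comp [::]; case: (mc M) => //; rewrite mul0n ltn0. Qed.

Lemma game_verifier_complete w : LKG (f w) ->
  exists P, halt_prob_ge S game_verifier w P (vacc game_verifier) 1.
Proof.
move=> /LKGP win; have [k run_f] := computes_halting_run w comp.
have retry := retriable_lottery computes_mc_gt0 eps_gt0 run_f win.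
apply: (safe_halt_prob (default_message M) (accept_prob_gt0 eps_gt0 k) retry).
exact: (safe_restart computes_mc_gt0 eps_gt0 run_f win).
Qed.

Lemma game_verifier_sound w : ~ LKG (f w) ->
  forall P, halt_prob_ge S game_verifier w P (vrej game_verifier) (1 - eps).
Proof.
rewrite LKGP => /not_winning lose; have [k run_f] := computes_halting_run w comp.
have [v le_v rej_v] := rejects_restart_bound computes_mc_gt0 eps_gt0 run_f lose.
by apply: rejects_ge_halt_prob; apply: rejects_ge_le le_v _; apply: rej_v.
Qed.

End Verification.

Theorem theorem8 (S : finType) (L : seq S -> Prop) :
  lin_space_reducible L LKG ->
  forall eps : rat, 0 < eps -> eps < 1 / 2 ->
  exists V : verifier S, verifies V L eps /\ perfect_completeness V L.
Proof.
case=> M [f [comp red]] eps eps_gt0 _.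
have complete : perfect_completeness (game_verifier M eps) L.
  by move=> w /red; apply: game_verifier_complete.
exists (game_verifier M eps); split=> //; split.
  exact/wf_prog_verifier/accepting_rejecting.
split=> [w /complete[P acc_P]|w not_L]; last first.
  by apply: game_verifier_sound => // /red.
exists P => d d_gt0; have [t le_t] := acc_P d d_gt0.
by exists t; apply: le_trans le_t; lra.
Qed.
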